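(* The matroids $\mathrm{PG}(3,2)\backslash L$ and $M^*(K_6)$ are excluded minors for the class of even-cycle matroids with a blocking pair; that is, neither is an even-cycle matroid with a blocking pair, but every proper minor of each of them is.
   Context: Even-cycle matroid: a binary matroid $M\binom{w}{D}$ where $D$ is the vertex-edge incidence matrix over $\mathrm{GF}(2)$ of a graph $G=(V,E)$ and $w$ is the characteristic vector of a set $W\subseteq E$ (odd edges); $(G,W)$ is an even-cycle representation. Resigning at a vertex $u$ replaces $W$ by its symmetric difference with the set of edges incident with $u$. Vertices $u,v$ form a blocking pair of $(G,W)$ if after some sequence of resignings every odd edge is incident with $u$ or $v$. An even-cycle matroid has a blocking pair if some even-cycle representation of it has a blocking pair. $\mathrm{PG}(3,2)\backslash L$ is $\mathrm{PG}(3,2)$ with the three points of a line deleted. *)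

(* Defs.v *)
From mathcomp Require Import all_boot all_algebra.

Set Implicit Arguments.
Unset Strict Implicit.
Unset Printing Implicit Defensive.

Import GRing.Theory.
Local Open Scope ring_scope.

Record matroid (T : finType) := Matroid {
  ground : {set T};
  indep : pred {set T};
  indep_ground : forall I, indep I -> I \subset ground;
  indep0 : indep set0;
  indep_sub : forall I J : {set T}, I \subset J -> indep J -> indep I;
  indep_aug : forall I J : {set T}, indep I -> indep J -> (#|I| < #|J|)%N ->
    exists2 e, e \in J :\: I & indep (e |: I)
}.

Definition matroid_iso (T U : finType) (M : matroid T) (N : matroid U) : Prop :=
  exists f : {x : T | x \in ground M} -> U,
    [/\ injective f,
        f @: setT = ground N
      & forall I : {set {x : T | x \in ground M}},
          indep M (val @: I) = indep N (f @: I)].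

Section MatroidOperations.

Variables (T : finType) (M : matroid T).

Definition basis (B : {set T}) : bool := maxset (indep M) B.

Lemma basisP (B : {set T}) :
  reflect (indep M B /\ forall J, indep M J -> (#|J| <= #|B|)%N) (basis B).
Proof.
apply: (iffP idP) => [mB | [iB max]].
  split=> [|J iJ]; first exact: maxsetp mB.
  rewrite leqNgt; apply/negP => /(indep_aug (maxsetp mB) iJ) [e].
  rewrite inE => /andP[eB _] ieB; case/negP: eB.
  by rewrite -(maxsetsup mB ieB (subsetUr _ _)) setU11.
apply/maxsetP; split=> // J iJ sBJ; apply/eqP.
by rewrite eq_sym eqEcard sBJ max.
Qed.

Lemma indep_extend (I S B : {set T}) :
  indep M I -> I \subset S -> basis B -> B \subset S ->
  exists2 B', basis B' & (I \subset B') && (B' \subset S).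
Proof.
move=> iI sIS /basisP[iB maxB] sBS.
have [B' mB' sIB'] : {B' | maxset (fun J => indep M J && (J \subset S)) B' & I \subset B'}.
  by apply: maxset_exists; rewrite iI.
have /andP[iB' sB'S] := maxsetp mB'.
exists B'; last by rewrite sIB'.
apply/basisP; split=> // J iJ; apply: leq_trans (maxB J iJ) _.
rewrite leqNgt; apply/negP => /(indep_aug iB' iB) [e].
rewrite inE => /andP[eB' eB] ieB'; case/negP: eB'.
have H : indep M (e |: B') && (e |: B' \subset S).
  by rewrite ieB' subUset sB'S sub1set (subsetP sBS).
by rewrite -(maxsetsup mB' H (subsetUr _ _)) setU11.
Qed.

Definition delete_indep (D I : {set T}) := indep M I && [disjoint I & D].

Lemma delete_ground D I : delete_indep D I -> I \subset ground M :\: D.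
Proof. by case/andP=> /indep_ground sI dI; rewrite subsetD sI. Qed.

Lemma delete0 D : delete_indep D set0.
Proof. by rewrite /delete_indep indep0 -setI_eq0 set0I eqxx. Qed.

Lemma delete_sub D (I J : {set T}) :
  I \subset J -> delete_indep D J -> delete_indep D I.
Proof.
move=> sIJ /andP[iJ dJ]; rewrite /delete_indep (indep_sub sIJ iJ).
exact: disjointWl sIJ dJ.
Qed.

Lemma delete_aug D (I J : {set T}) :
  delete_indep D I -> delete_indep D J -> (#|I| < #|J|)%N ->
  exists2 e, e \in J :\: I & delete_indep D (e |: I).
Proof.
case/andP=> iI dI /andP[iJ dJ] /(indep_aug iI iJ)[e eJI ieI]; exists e => //.
rewrite /delete_indep ieI -setI_eq0 setIUl setU_eq0 !setI_eq0 dI andbT.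
by move: eJI; rewrite inE disjoints1 => /andP[_ /(disjointFr dJ) ->].
Qed.

Definition delete (D : {set T}) : matroid T :=
  Matroid (@delete_ground D) (delete0 D) (@delete_sub D) (@delete_aug D).

(* The bases of the dual are the complements of the bases of [M]. *)
Definition dual_indep (I : {set T}) :=
  (I \subset ground M) && [exists B : {set T}, basis B && [disjoint I & B]].

Lemma dual_ground I : dual_indep I -> I \subset ground M.
Proof. by case/andP. Qed.

Lemma dual0 : dual_indep set0.
Proof.
rewrite /dual_indep sub0set; apply/existsP.
have [B mB _] := maxset_exists (indep0 M).
by exists B; rewrite /basis mB -setI_eq0 set0I eqxx.
Qed.

Lemma dual_sub (I J : {set T}) : I \subset J -> dual_indep J -> dual_indep I.
Proof.
move=> sIJ /andP[sJ /existsP[B /andP[bB dJB]]].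
rewrite /dual_indep (subset_trans sIJ sJ); apply/existsP; exists B.
by rewrite bB (disjointWl sIJ dJB).
Qed.

Lemma dual_aug (I J : {set T}) :
  dual_indep I -> dual_indep J -> (#|I| < #|J|)%N ->
  exists2 e, e \in J :\: I & dual_indep (e |: I).
Proof.
case/andP=> sI /existsP[A /andP[bA dIA]] /andP[sJ /existsP[B /andP[bB dJB]]] ltIJ.
have iB := maxsetp bB.
have [B' bB' /andP[sBB' sB'I]] :
    exists2 B', basis B' & (B :\: I \subset B') && (B' \subset ~: I).
  apply: (indep_extend (indep_sub (subsetDl B I) iB) _ bA).
    by rewrite setDE subsetIr.
  by rewrite -disjoints_subset disjoint_sym.
have [sJIB' | /subsetPn[e eJI eB']] := boolP (J :\: I \subset B'); last first.
  exists e => //; move: eJI; rewrite inE => /andP[eI eJ].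
  rewrite /dual_indep subUset sub1set (subsetP sJ) // sI /=.
  apply/existsP; exists B'; rewrite bB' -setI_eq0 setIUl setU_eq0 !setI_eq0.
  by rewrite disjoints1 eB' disjoint_sym disjoints_subset sB'I.
have leBB' : (#|B'| <= #|B|)%N.
  by have /basisP[iB' _] := bB'; have /basisP[_] := bB; apply.
have d1 : [disjoint J :\: I & B :\: I].
  by apply: disjointWl (subsetDl _ _) _; apply: disjointWr (subsetDl _ _) _.
have le1 : (#|J :\: I| + #|B :\: I| <= #|B'|)%N.
  rewrite -cardsUI (_ : _ :&: _ = set0); last by apply/eqP; rewrite setI_eq0.
  by rewrite cards0 addn0 subset_leq_card // subUset sJIB' sBB'.
have le2 : (#|B :&: I| <= #|I :\: J|)%N.
  apply/subset_leq_card/subsetP => x; rewrite !inE => /andP[xB ->].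
  by rewrite (disjointFl dJB xB).
have := cardsID I B; have := cardsID I J; have := cardsID J I => eI eJ eB.
suff: (#|B| < #|B'|)%N by rewrite ltnNge leBB'.
apply: leq_trans le1; rewrite -eB -addSn leq_add2r.
apply: leq_ltn_trans le2 _.
by rewrite -(ltn_add2l #|I :&: J|) eI setIC eJ.
Qed.

Definition dual : matroid T := Matroid dual_ground dual0 dual_sub dual_aug.

End MatroidOperations.

Definition contract (T : finType) (M : matroid T) (C : {set T}) : matroid T :=
  dual (delete (dual M) C).

Definition matroid_class := forall T : finType, matroid T -> Prop.

Definition excluded_minor (P : matroid_class) (T : finType) (M : matroid T) : Prop :=
  ~ P T M /\
  forall C D : {set T},
    C \subset ground M -> D \subset ground M -> [disjoint C & D] ->
    C :|: D != set0 -> P T (delete (contract M C) D).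

Section VectorMatroid.

Variables (F : fieldType) (vT : vectType F) (T : finType).
Variables (f : T -> vT) (S : {set T}).

(* [free] looks at the list, so equal vectors with distinct labels count as
   dependent. *)
Definition vector_indep (I : {set T}) := (I \subset S) && free [seq f e | e <- enum I].

Lemma free_setU1 (e : T) (I : {set T}) : e \notin I ->
  free [seq f x | x <- enum (e |: I)] = free (f e :: [seq f x | x <- enum I]).
Proof.
move=> eI; rewrite -map_cons; apply/perm_free/perm_map/uniq_perm.
- exact: enum_uniq.
- by rewrite /= mem_enum eI enum_uniq.
- by move=> x; rewrite inE !mem_enum !inE.
Qed.

Lemma free_subset (I J : {set T}) : I \subset J ->
  free [seq f x | x <- enum J] -> free [seq f x | x <- enum I].
Proof.
move=> sIJ; have /perm_free -> : perm_eq [seq f x | x <- enum J]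
    ([seq f x | x <- enum I] ++ [seq f x | x <- enum (J :\: I)]).
  rewrite -map_cat; apply/perm_map/uniq_perm.
  - exact: enum_uniq.
  - rewrite cat_uniq !enum_uniq andbT -all_predC; apply/allP => x /=.
    by rewrite !mem_enum inE => /andP[].
  - move=> x; rewrite mem_cat !mem_enum inE.
    by case: (boolP (x \in I)) => //= /(subsetP sIJ).
exact: catl_free.
Qed.

Lemma vector_ground I : vector_indep I -> I \subset S.
Proof. by case/andP. Qed.

Lemma vector0 : vector_indep set0.
Proof. by rewrite /vector_indep sub0set enum_set0 nil_free. Qed.

Lemma vector_sub (I J : {set T}) : I \subset J -> vector_indep J -> vector_indep I.
Proof.
move=> sIJ /andP[sJ fJ].
by rewrite /vector_indep (subset_trans sIJ sJ) (free_subset sIJ fJ).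
Qed.

Lemma vector_aug (I J : {set T}) :
  vector_indep I -> vector_indep J -> (#|I| < #|J|)%N ->
  exists2 e, e \in J :\: I & vector_indep (e |: I).
Proof.
case/andP=> sI fI /andP[sJ fJ] ltIJ.
have [sub | ] := boolP (all (mem <<[seq f x | x <- enum I]>>%VS) [seq f x | x <- enum J]).
  have /dimvS : (<<[seq f x | x <- enum J]>> <= <<[seq f x | x <- enum I]>>)%VS.
    by apply/span_subvP/allP.
  move: fI fJ; rewrite /free => /eqP-> /eqP->.
  by rewrite !size_map -!cardE leqNgt ltIJ.
rewrite -has_predC => /hasP[x /mapP[e]]; rewrite mem_enum => eJ {x}-> /= enI.
have eI : e \notin I.
  by apply: contra enI => eI; rewrite memv_span // map_f // mem_enum.
exists e; first by rewrite inE eI.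
rewrite /vector_indep subUset sub1set (subsetP sJ) // sI free_setU1 //.
by rewrite free_cons fI !andbT /=.
Qed.

Definition vector_matroid : matroid T :=
  Matroid vector_ground vector0 vector_sub vector_aug.

End VectorMatroid.

(* The columns of [A] are labelled by [T] through [enum_rank]. *)
Definition matrix_matroid (F : fieldType) (T : finType) (m : nat)
    (A : 'M[F]_(m, #|T|)) : matroid T :=
  vector_matroid (fun e => col (enum_rank e) A) [set: T].

(* Over GF(2), a point of projective space is spanned by a unique nonzero vector. *)
Definition PG32 : matroid 'rV['F_2]_4 := vector_matroid (fun x : 'rV['F_2]_4 => x) [set x | x != 0].

Definition PG32_line (L : {set 'rV['F_2]_4}) : Prop :=
  exists x y, [/\ x != 0, y != 0, x != y & L = [set x; y; x + y]].

(* Parallel edges are allowed; a loop is an edge whose set of ends is a singleton. *)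
Record graph := Graph {
  vertex : finType;
  edge : finType;
  ends : edge -> {set vertex};
  ends_card : forall e, (0 < #|ends e| <= 2)%N
}.

(* The column of a loop is zero. *)
Definition incidence_mx (G : graph) : 'M['F_2]_(#|vertex G|, #|edge G|) :=
  \matrix_(i, j) ((enum_val i \in ends (enum_val j)) && (#|ends (enum_val j)| == 2))%:R.

(* Vertices vs_0, ..., vs_(k-1) are distinct and the i-th edge has ends vs_i and
   vs_(i+1 mod k); a loop is a cycle with k = 1 and a pair of parallel edges is
   one with k = 2. *)
Definition is_cycle (G : graph) (C : {set edge G}) : bool :=
  (C != set0) &&
  [exists vs : #|C|.-tuple (vertex G), [exists es : #|C|.-tuple (edge G),
    [&& uniq vs, uniq es, C == [set e in es]
      & [seq ends e | e <- es] == [seq [set p.1; p.2] | p <- zip vs (rot 1 vs)]]]].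

Definition acyclic (G : graph) (I : {set edge G}) : bool :=
  [forall C : {set edge G}, is_cycle C ==> ~~ (C \subset I)].

Section CycleMatroid.

Lemma F2_neq0 (x : 'F_2) : x != 0 -> x = 1.
Proof. by case: x => [[|[|?]]] // ? _; apply: val_inj. Qed.

Lemma F2_free (vT : vectType 'F_2) (T : finType) (f : T -> vT) (I : {set T}) :
  reflect (forall S : {set T}, S \subset I -> \sum_(e in S) f e = 0 -> S = set0)
          (free [seq f e | e <- enum I]).
Proof.
apply: (iffP idP) => [fI S sSI S0 | noS].
  apply/eqP/set0Pn => -[e eS].
  have := free_subset sSI fI; rewrite -(setD1K eS) free_setU1 ?setD11 //.
  rewrite free_cons => /andP[/negP[]].
  have -> : f e = - \sum_(x in S :\ e) f x.
    by apply/eqP; rewrite -addr_eq0 -big_setD1 ?S0.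
  rewrite memvN; apply: memv_suml => x xS.
  by rewrite memv_span // map_f // mem_enum.
pose X := [tuple f (enum_val i) | i < #|I|].
have -> : [seq f e | e <- enum I] = X.
  by rewrite /= -{1}(map_tnth_enum (enum_tuple I)) -map_comp; apply: eq_map => i /=;
     rewrite (tnth_nth (enum_default i)).
apply/freeP => k k0 i; apply/eqP/negPn/negP => ki.
have: [set enum_val j | j in [set j | k j != 0]] = set0; last first.
  by move/setP/(_ (enum_val i)); rewrite in_set0 imset_f // inE.
apply: noS.
- by apply/subsetP => _ /imsetP[j _ ->]; apply: enum_valP.
- rewrite big_imset /=; last by move=> ? ? _ _; apply: enum_val_inj.
  rewrite -[RHS]k0 [RHS](bigID (fun j => k j != 0)) /=.
  rewrite [X in _ = _ + X]big1 ?addr0 => [|j /negPn/eqP->]; last by rewrite scale0r.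
  apply: eq_big => [j | j]; rewrite inE // => /F2_neq0 ->.
  by rewrite scale1r nth_mktuple.
Qed.

Variable G : graph.
Local Notation V := (vertex G).
Local Notation E := (edge G).

Definition inc_col (e : E) : 'cV['F_2]_#|V| := col (enum_rank e) (incidence_mx G).

Lemma inc_colE (e : E) (a b : V) : ends e = [set a; b] ->
  inc_col e = delta_mx (enum_rank a) 0 + delta_mx (enum_rank b) 0.
Proof.
move=> He; apply/matrixP => i j; rewrite !mxE enum_rankK He ord1 !eqxx !andbT.
rewrite cards2 !inE -[i]enum_valK !(inj_eq enum_rank_inj) enum_valK.
move: (enum_val i) => x {i j}.
have [<-{b He} | nab] := eqVneq a b.
  by rewrite andbF; case: eqP => _; apply: val_inj.
rewrite andbT; have [->|_] := eqVneq x a; first by rewrite (negbTE nab) addr0.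
by rewrite add0r.
Qed.

Lemma cycle_sum (C : {set E}) : is_cycle C -> \sum_(e in C) inc_col e = 0.
Proof.
case/andP=> _ /existsP[vs /existsP[es /and4P[_ ues /eqP/setP HC /eqP Hes]]].
rewrite (eq_bigl (fun e => e \in es)) => [|e]; last by rewrite HC inE.
rewrite -big_uniq //=.
pose h (v : V) : 'cV['F_2]_#|V| := delta_mx (enum_rank v) 0.
have szv : size (rot 1 vs) = size vs by rewrite size_rot.
have szz : size (zip vs (rot 1 vs)) = size es.
  by rewrite size_zip szv minnn !size_tuple.
have -> : \sum_(e <- es) inc_col e = \sum_(p <- zip vs (rot 1 vs)) (h p.1 + h p.2).
  elim: (tval es) (zip _ _) Hes {szz} => [|e s IH] [|p z] //=; first by rewrite !big_nil.
  by case=> He /IH Hs; rewrite !big_cons Hs (inc_colE He).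
rewrite big_split /= -(big_map fst xpredT h) -(big_map snd xpredT h).
rewrite -/(unzip1 _) -/(unzip2 _).
rewrite unzip1_zip ?szv // unzip2_zip ?szv //.
rewrite [X in _ + X](perm_big vs) /=; last by rewrite perm_rot.
by rewrite -mulr2n -scaler_nat (_ : 2%:R = 0 :> 'F_2) ?scale0r //; apply: val_inj.
Qed.

Lemma loop_cycle (e : E) (a : V) : ends e = [set a] -> is_cycle [set e].
Proof.
move=> He; apply/andP; split; first by apply/set0Pn; exists e; rewrite inE.
rewrite /= cards1; apply/existsP; exists [tuple a]; apply/existsP; exists [tuple e].
apply/and4P; split=> //=; first by apply/eqP/setP => x; rewrite !inE.
by rewrite He; apply/eqP; congr [:: _]; apply/setP => x; rewrite !inE orbb.
Qed.

Lemma sum0_degree (S : {set E}) (e : E) (v : V) :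
  \sum_(x in S) inc_col x = 0 -> e \in S -> #|ends e| = 2 -> v \in ends e ->
  exists x, [&& x \in S, x != e & v \in ends x].
Proof.
move=> S0 eS c2 ve; apply/existsP; apply: contraT; rewrite negb_exists => /forallP no.
have /matrixP/(_ (enum_rank v) 0) := S0.
rewrite summxE (big_setD1 e) //= big1 ?addr0.
  by rewrite !mxE !enum_rankK ve c2.
move=> x; rewrite inE in_set1 => /andP[xe xS]; rewrite !mxE !enum_rankK.
by have := no x; rewrite xS xe /= => /negbTE->.
Qed.

Lemma walk_cycle (S : {set E}) (v : nat -> V) (e : nat -> E) (i j : nat) :
  (i < j)%N -> v j = v i -> (forall k, e k \in S) -> (forall k, e k.+1 != e k) ->
  (forall k, ends (e k) = [set v k; v k.+1]) ->
  (forall a b, (a < j)%N -> (b < j)%N -> v a = v b -> a = b) ->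
  exists2 C : {set E}, is_cycle C & C \subset S.
Proof.
move=> ij vij eS ne He vinj; pose s := iota i (j - i).
have ms k : (k \in s) = (i <= k < j)%N by rewrite mem_iota subnKC // ltnW.
have uv : uniq (map v s).
  rewrite map_inj_in_uniq ?iota_uniq // => a b; rewrite !ms => /andP[_ aj] /andP[_ bj].
  exact: vinj.
have lt_e a b : (a < b < j)%N -> e a <> e b.
  case/andP=> ab bj eab; have := He b; rewrite -eab He => /setP Hs.
  have aj := ltn_trans ab bj.
  have := Hs (v b); rewrite !inE eqxx /= => /orP[] /eqP.
    by move/(vinj _ _ bj aj) => H; rewrite H ltnn in ab.
  move/(vinj _ _ bj (leq_ltn_trans ab bj)) => H.
  by have := ne a; rewrite -H -eab eqxx.
have ue : uniq (map e s).
  rewrite map_inj_in_uniq ?iota_uniq // => a b; rewrite !ms => /andP[_ aj] /andP[_ bj] eab.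
  case: (ltngtP a b) => // ab; exfalso.
    by apply: (lt_e a b) => //; rewrite ab.
  by apply: (lt_e b a) => //; rewrite ab.
pose C := [set x in map e s]; exists C; last first.
  by apply/subsetP => x; rewrite inE => /mapP[k _ ->].
have cC : #|C| = size s by rewrite cardsE (card_uniqP ue) size_map.
have szs : size s = (j - i)%N by rewrite size_iota.
apply/andP; split; first by rewrite -card_gt0 cC szs subn_gt0.
have tv : size (map v s) == #|C| by rewrite size_map cC.
have te : size (map e s) == #|C| by rewrite size_map cC.
apply/existsP; exists (Tuple tv); apply/existsP; exists (Tuple te).
rewrite /= uv ue eqxx /=; apply/eqP.
have -> : rot 1 (map v s) = map (fun k => v k.+1) s.
  have [n jn] : exists n, j = (i + n).+1 by exists (j - i.+1)%N; rewrite -addSn subnKC.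
  rewrite /s jn -addnS addKn /= rot1_cons -vij jn.
  elim: n (i) {jn} => [|n IH] m /=; first by rewrite addn0.
  by rewrite addnS -addSn IH.
by rewrite -map_comp zip_map -map_comp; apply: eq_map => k /=.
Qed.

Lemma sum0_cycle (S : {set E}) : S != set0 -> \sum_(e in S) inc_col e = 0 ->
  exists2 C : {set E}, is_cycle C & C \subset S.
Proof.
move=> /set0Pn[e0 e0S] S0.
have [/existsP[e /andP[eS /cards1P[a Ha]]] | noloop] := boolP [exists e in S, #|ends e| == 1%N].
  by exists [set e]; [exact: loop_cycle Ha | rewrite sub1set].
have c2 e : e \in S -> #|ends e| = 2.
  move=> eS; move: noloop; rewrite negb_exists => /forallP/(_ e); rewrite eS /=.
  by case/andP: (ends_card e); case: #|_| => [|[|[|]]].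
pose dart (d : V * E) := (d.2 \in S) && (d.1 \in ends d.2).
pose step (d d' : V * E) :=
  [&& dart d', d'.2 != d.2 & ends d.2 == [set d.1; d'.1]].
have ex_step d : dart d -> exists d', step d d'.
  case: d => x e /andP[/= eS xe].
  have /cards2P[a [b [nab Hab]]] : #|ends e| == 2 by rewrite c2.
  have [y Hy] : exists y, ends e = [set x; y].
    move: xe; rewrite Hab !inE => /orP[]/eqP->; first by exists b.
    by exists a; rewrite setUC.
  have [|e' /and3P[e'S ne ye]] := sum0_degree (v := y) S0 eS (c2 _ eS).
    by rewrite Hy !inE eqxx orbT.
  by exists (y, e'); rewrite /step /dart /= e'S ye ne Hy eqxx.
have [d0 d0P] : exists d0, dart d0.
  have /card_gt0P[x xe] : (0 < #|ends e0|)%N by rewrite c2.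
  by exists (x, e0); rewrite /dart /= e0S.
pose next d := odflt d [pick d' | step d d'].
have nextP d : dart d -> step d (next d).
  move=> dd; rewrite /next; case: pickP => //= no.
  by have [d'] := ex_step _ dd; rewrite no.
pose w k := iter k next d0.
have wP k : dart (w k).
  by elim: k => //= k IH; have /and3P[] := nextP _ IH.
pose v k := (w k).1; pose e k := (w k).2.
have rep : exists j, v j \in [seq v k | k <- iota 0 j].
  have [/hasP[j _ Hj] | no] := boolP (has (fun j => v j \in [seq v k | k <- iota 0 j]) (iota 0 #|V|.+1)).
    by exists j.
  have u n : (n <= #|V|.+1)%N -> uniq [seq v k | k <- iota 0 n].
    elim: n => // n IH ln; rewrite -addn1 iotaD map_cat /= cats1 rcons_uniq IH ?(ltnW ln) // andbT.
    by move: no => /hasPn; apply; rewrite mem_iota.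
  have := u _ (leqnn _) => /card_uniqP; rewrite size_map size_iota => H.
  by have := max_card (mem [seq v k | k <- iota 0 #|V|.+1]); rewrite H ltnn.
case: (ex_minnP rep) => j /mapP[i]; rewrite mem_iota /= add0n => ij vij jmin.
have lt_v a b : (a < b < j)%N -> v a <> v b.
  case/andP=> ab bj vab; have := jmin b; rewrite leqNgt bj => H.
  by suff: false by []; apply: H; rewrite -vab map_f // mem_iota.
apply: (walk_cycle (v := v) (e := e) ij vij) => [k|k|k|a b aj bj vab].
- by case/andP: (wP k).
- by case/and3P: (nextP _ (wP k)).
- by case/and3P: (nextP _ (wP k)) => _ _ /eqP.
- case: (ltngtP a b) => // ab; exfalso.
    by apply: (lt_v a b) => //; rewrite ab.
  by apply: (lt_v b a) => //; rewrite ab.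
Qed.

Lemma acyclicE (I : {set E}) : acyclic I = free [seq inc_col e | e <- enum I].
Proof.
apply/forallP/F2_free => [noC S sSI S0 | noS C].
  apply/eqP/negPn/negP => /sum0_cycle/(_ S0)[C cC sCS].
  by have := noC C; rewrite cC (subset_trans sCS sSI).
apply/implyP => cC; apply/negP => sCI.
by have := cC; rewrite /is_cycle (noS C sCI (cycle_sum cC)) eqxx.
Qed.

Lemma cycle_ground (I : {set E}) : acyclic I -> I \subset [set: E].
Proof. by rewrite subsetT. Qed.

Lemma cycle0 : acyclic (set0 : {set E}).
Proof. by rewrite acyclicE enum_set0 nil_free. Qed.

Lemma cycle_sub (I J : {set E}) : I \subset J -> acyclic J -> acyclic I.
Proof. by move=> sIJ; rewrite !acyclicE; apply: free_subset. Qed.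

Lemma cycle_aug (I J : {set E}) : acyclic I -> acyclic J -> (#|I| < #|J|)%N ->
  exists2 e, e \in J :\: I & acyclic (e |: I).
Proof.
rewrite !acyclicE => aI aJ ltIJ.
have := @vector_aug _ _ _ inc_col setT I J.
rewrite /vector_indep !subsetT => /(_ aI aJ ltIJ)[e eJI /andP[_ fe]].
by exists e; rewrite // acyclicE.
Qed.

Definition cycle_matroid : matroid E :=
  Matroid cycle_ground cycle0 cycle_sub cycle_aug.

End CycleMatroid.

Definition complete_edge (n : nat) := {e : {set 'I_n} | #|e| == 2}.

Lemma complete_ends_card n (e : complete_edge n) : (0 < #|val e| <= 2)%N.
Proof. by rewrite (eqP (valP e)). Qed.

Definition complete_graph (n : nat) : graph :=
  @Graph 'I_n (complete_edge n : finType) val (@complete_ends_card n).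

Definition char_row (T : finType) (W : {set T}) : 'rV['F_2]_#|T| :=
  \row_j (enum_val j \in W)%:R.

Definition even_cycle_matroid (G : graph) (W : {set edge G}) : matroid (edge G) :=
  matrix_matroid (col_mx (char_row W) (incidence_mx G)).

Definition even_cycle_rep (T : finType) (M : matroid T) (G : graph) (W : {set edge G}) :
  Prop := matroid_iso M (even_cycle_matroid W).

(* The support of the row of [u] in the incidence matrix: adding that row to the
   characteristic vector of [W] leaves the matroid unchanged, and in particular
   loops keep their parity. *)
Definition star (G : graph) (u : vertex G) : {set edge G} :=
  [set e | incidence_mx G (enum_rank u) (enum_rank e) != 0].

Definition resign (G : graph) (W : {set edge G}) (u : vertex G) : {set edge G} :=
  (W :\: star u) :|: (star u :\: W).

Definition blocking_pair (G : graph) (W : {set edge G}) (u v : vertex G) : Prop :=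
  u != v /\
  exists us : seq (vertex G),
    forall e, e \in foldl (@resign G) W us -> (u \in ends e) || (v \in ends e).

Definition even_cycle_with_blocking_pair : matroid_class := fun T M =>
  exists (G : graph) (W : {set edge G}),
    even_cycle_rep M W /\ exists u v : vertex G, blocking_pair W u v.

(* Main.v *)
Require Import Defs.
From mathcomp Require Import all_boot all_algebra zify.

(** Resigning so that every odd edge meets [u] or [v], and measuring vertices from
    [u], a signed graph with blocking pair [u, v] is a binary matrix with columns in
    [F_2^2 + F_2^n], where [F_2^2] is spanned by the odd loop and the edge [uv]: a column
    has at most two nonzero lower coordinates, and at most one unless its upper part
    vanishes. This shape survives deletion and contraction, so only single-element
    minors need explicit representations.

    For the converse, let [P, Q] be the two upper rows and [R] the sum of the lower ones
    (the star of [u]). A column lies in at most two of the lower rows, in at most one of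
    them if it lies in [R], and in none of them if it lies in [P] or [Q] but not in [R].
    With [m] columns, rank [r], nonzero cocycles of weight at least [w], [l] nonzero
    lower rows, [d] the rank of [P, Q, R] and [s] the size of their joint support, this
    gives [w l + 2 s <= |R| + 2 m] and [r <= d + l - 1], while averaging over the span
    of [P, Q, R] gives [2 w (2^d - 1) <= 2^d s]. For [PG(3,2) \ L] ([r = 4], [m = 12],
    [w = 6], [|R| <= 8]) this is contradictory; for [M*(K_6)] ([r = 10], [m = 15],
    [w = 3]) it forces [d = 3] and [s = |R| = 6], and then [P], [Q], [P + Q] all have
    weight 3, which is impossible by parity. *)

Set Implicit Arguments.
Unset Strict Implicit.
Unset Printing Implicit Defensive.

Import GRing.Theory.

(** * Finite sets *)

Section FiniteSets.

Variable T : finType.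
Implicit Types A B C S : {set T}.

Definition symdiff A B : {set T} := [set x | (x \in A) (+) (x \in B)].

Lemma in_symdiff A B x : (x \in symdiff A B) = (x \in A) (+) (x \in B).
Proof. by rewrite inE. Qed.

Lemma symdiffAC A B C : symdiff (symdiff A B) C = symdiff (symdiff A C) B.
Proof. by apply/setP => x; rewrite !inE addbAC. Qed.

Lemma symdiffK B : involutive (symdiff^~ B).
Proof. by move=> A; apply/setP => x; rewrite !inE addbK. Qed.

Lemma symdiff_subset A B C : A \subset C -> B \subset C -> symdiff A B \subset C.
Proof.
move=> /subsetP sA /subsetP sB; apply/subsetP => x; rewrite in_symdiff.
by case: (boolP (x \in A)) => [/sA //|_ /sB].
Qed.

Lemma card_symdiff A B : (#|symdiff A B| + 2 * #|A :&: B| = #|A| + #|B|)%N.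
Proof.
have -> : symdiff A B = (A :\: B) :|: (B :\: A).
  by apply/setP => x; rewrite !inE; case: (x \in A); case: (x \in B).
have disjAB : (A :\: B) :&: (B :\: A) = set0.
  by apply/setP => x; rewrite !inE; case: (x \in A); rewrite ?andbF.
have := cardsUI (A :\: B) (B :\: A); rewrite disjAB cards0.
by have := cardsID A B; have := cardsID B A; rewrite [B :&: A]setIC; lia.
Qed.

Lemma odd_card_symdiff A B : odd #|symdiff A B| = odd #|A| (+) odd #|B|.
Proof. by rewrite -oddD -card_symdiff oddD mul2n odd_double addbF. Qed.

Lemma setI_symdiff S A B : S :&: symdiff A B = symdiff (S :&: A) (S :&: B).
Proof. by apply/setP => x; rewrite !inE; case: (x \in S). Qed.

Lemma sum_mem_in S A : (\sum_(x in S) (x \in A) = #|S :&: A|)%N.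
Proof.
rewrite -sum1_card big_mkcond [RHS]big_mkcond; apply: eq_bigr => x _.
by rewrite inE; case: (x \in S).
Qed.

Lemma sum_mem A : (\sum_x (x \in A) = #|A|)%N.
Proof. by rewrite -[in RHS](setTI A) -sum_mem_in; apply: eq_bigl => x; rewrite inE. Qed.

End FiniteSets.

Lemma odd_sum (I : finType) (P : pred I) (F : I -> nat) :
  odd (\sum_(i | P i) F i) = \big[addb/false]_(i | P i) odd (F i).
Proof. exact: (big_morph odd oddD). Qed.

(** * Binary matroids and their cycle spaces *)

Section CycleSpaces.

Variable T : finType.
Implicit Types (M : matroid T) (Z : pred {set T}) (A B C D I S : {set T}).

Definition cycle_space Z := Z set0 /\ forall A B, Z A -> Z B -> Z (symdiff A B).

Definition cycle_free Z I := [forall S : {set T}, (S \subset I) && Z S ==> (S == set0)].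

Definition represented M Z :=
  forall I, indep M I = (I \subset ground M) && cycle_free Z I.

Lemma cycle_freeP Z I :
  reflect (forall S, S \subset I -> Z S -> S = set0) (cycle_free Z I).
Proof.
apply: (iffP forallP) => [freeI S sSI zS|freeI S].
  by apply/eqP; have := freeI S; rewrite sSI zS.
by apply/implyP => /andP[sSI zS]; rewrite (freeI S).
Qed.

Lemma cycle_freePn Z I :
  reflect (exists S, [/\ S \subset I, Z S & S != set0]) (~~ cycle_free Z I).
Proof.
apply: (iffP forallPn) => -[S].
  by rewrite negb_imply => /andP[/andP[sSI zS] nS]; exists S.
by case=> sSI zS nS; exists S; rewrite negb_imply sSI zS.
Qed.

Lemma eq_cycle_free Z1 Z2 I :
  (forall S, S \subset I -> Z1 S = Z2 S) -> cycle_free Z1 I = cycle_free Z2 I.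
Proof.
by move=> eqZ; apply: eq_forallb => S; case: (boolP (S \subset I)) => //= /eqZ->.
Qed.

Lemma represented_delete M Z D : represented M Z -> represented (delete M D) Z.
Proof. by move=> repM I; rewrite /= /delete_indep subsetD repM andbAC. Qed.

Lemma fundamental_cycle M Z B y : represented M Z -> indep M B -> y \in ground M ->
  ~~ indep M (y |: B) -> exists S, [/\ S \subset y |: B, Z S & y \in S].
Proof.
move=> repM iB yM; have syB : y |: B \subset ground M by rewrite subUset sub1set yM indep_ground.
rewrite repM syB => /cycle_freePn[S [sS zS nS]]; exists S; split=> //.
apply: contraNT nS => yS; move: iB; rewrite repM => /andP[_ /cycle_freeP freeB].
apply/eqP/freeB => //; apply/subsetP => x xS.
have := subsetP sS x xS; rewrite in_setU1 => /predU1P[xy|//].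
by rewrite -xy xS in yS.
Qed.

Definition circuit Z C := minset (fun S : {set T} => (S != set0) && Z S) C.

Lemma circuit_represented M Z1 Z2 C : represented M Z1 -> represented M Z2 ->
  C \subset ground M -> circuit Z1 C -> Z2 C.
Proof.
move=> rep1 rep2 sC /minsetP[/andP[nC zC] minC].
have dep1 : ~~ indep M C by rewrite rep1 sC; apply/cycle_freePn; exists C.
have [D [sDC zD nD]] : exists D, [/\ D \subset C, Z2 D & D != set0].
  by apply/cycle_freePn; rewrite rep2 sC in dep1.
have sD := subset_trans sDC sC.
have dep2 : ~~ indep M D by rewrite rep2 sD; apply/cycle_freePn; exists D.
have [S [sSD zS nS]] : exists S, [/\ S \subset D, Z1 S & S != set0].
  by apply/cycle_freePn; rewrite rep1 sD in dep2.
have eSC : S = C by apply: minC; rewrite ?nS // (subset_trans sSD).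
by rewrite (_ : C = D) //; apply/eqP; rewrite eqEsubset sDC -{1}eSC sSD.
Qed.

Lemma cycle_space_circuits Z1 Z2 S : cycle_space Z1 -> cycle_space Z2 ->
  (forall C, C \subset S -> circuit Z1 C -> Z2 C) -> Z1 S -> Z2 S.
Proof.
move=> [_ Z1D] [Z2_0 Z2D]; have [m] := ubnP #|S|.
elim: m S => // m IH S ltSm circS zS; have [->//|nS] := eqVneq S set0.
have [|C circC sCS] := @minset_exists _ (fun C : {set T} => (C != set0) && Z1 C) S.
  by rewrite nS.
have /minsetP[/andP[/set0Pn[x xC] zC] _] := circC.
have sSD : symdiff S C \subset S :\ x.
  apply/subsetP => y; rewrite !inE; case: eqVneq => [->|_].
    by rewrite xC (subsetP sCS).
  by case: (boolP (y \in C)) => [/(subsetP sCS)->|_] //; rewrite addbF.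
rewrite -(symdiffK C S); apply/Z2D/circS => //; apply: IH (Z1D _ _ zS zC).
  apply: leq_ltn_trans (subset_leq_card sSD) _.
  by move: ltSm; rewrite (cardsD1 x S) (subsetP sCS).
by move=> D sD; apply: circS; apply: subset_trans sD (subset_trans sSD (subsetDl _ _)).
Qed.

Lemma represented_uniq M Z1 Z2 S : cycle_space Z1 -> cycle_space Z2 ->
  represented M Z1 -> represented M Z2 -> S \subset ground M -> Z1 S = Z2 S.
Proof.
move=> cZ1 cZ2 rep1 rep2 sS; have sub C : C \subset S -> C \subset ground M.
  by move=> sC; apply: subset_trans sC sS.
apply/idP/idP; apply: cycle_space_circuits => // C /sub sC.
  exact: circuit_represented rep1 rep2 sC.
exact: circuit_represented rep2 rep1 sC.
Qed.

End CycleSpaces.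

(** * Contraction *)

Section Contraction.

Variables (T : finType) (M : matroid T).
Implicit Types (Z : pred {set T}) (A B C I J X Y : {set T}).

Lemma basis_sub_ground A : basis M A -> A \subset ground M.
Proof. by move=> /basisP[/indep_ground]. Qed.

Lemma card_basis A B : basis M A -> basis M B -> #|A| = #|B|.
Proof.
move=> /basisP[iA maxA] /basisP[iB maxB].
by apply/eqP; rewrite eqn_leq maxA // maxB.
Qed.

Lemma delete_dual_indepP C J :
  reflect (exists2 A, basis M A & J \subset ground M :\: C :\: A)
          (delete_indep (dual M) C J).
Proof.
apply: (iffP andP) => [[/andP[sJ /existsP[A /andP[bA dJA]]] dJC]|[A bA]].
  by exists A; rewrite // !subsetD sJ dJC dJA.
rewrite !subsetD => /andP[/andP[sJ dJC] dJA]; split=> //.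
by apply/andP; split=> //; apply/existsP; exists A; rewrite bA.
Qed.

Lemma card_setD_basis C A : C \subset ground M -> basis M A ->
  (#|ground M :\: C :\: A| + #|A| = #|ground M :\: C| + #|A :&: C|)%N.
Proof.
move=> sC /basis_sub_ground sA.
have := cardsID A (ground M :\: C); have := cardsID C A.
suff -> : (ground M :\: C) :&: A = A :\: C by lia.
by rewrite setIDAC (setIidPr sA).
Qed.

Definition relative_basis C B := maxset (fun J => indep M J && (J \subset C)) B.

Lemma relative_basis_exists C : exists B, relative_basis C B.
Proof.
have [|B] := @maxset_exists _ (fun J => indep M J && (J \subset C)) set0.
  by rewrite indep0 sub0set.
by exists B.
Qed.

Lemma card_relative_basis C B J :
  relative_basis C B -> indep M J -> J \subset C -> (#|J| <= #|B|)%N.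
Proof.
move=> /maxsetP[/andP[iB sBC] maxB] iJ sJC; rewrite leqNgt; apply/negP.
move=> /(indep_aug iB iJ)[e]; rewrite inE => /andP[eB eJ] ieB; case/negP: eB.
rewrite -(maxB (e |: B)) ?setU11 ?subsetUr //.
by rewrite ieB subUset sub1set (subsetP sJC).
Qed.

Lemma relative_basis_setI C A : C \subset ground M -> basis M A ->
  basis (delete (dual M) C) (ground M :\: C :\: A) -> relative_basis C (A :&: C).
Proof.
move=> sC bA /basisP[_ maxJ]; have [iA _] := basisP _ _ bA.
apply/maxsetP; split=> [|K /andP[iK sKC] sAK].
  by rewrite (indep_sub (subsetIl A C) iA) subsetIr.
have [A' bA' /andP[sKA' _]] := indep_extend iK (subsetUl K A) bA (subsetUr K A).
apply/esym/eqP; rewrite eqEcard sAK.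
have := maxJ _ (introT (delete_dual_indepP C _) (ex_intro2 _ _ A' bA' (subxx _))).
have := card_setD_basis sC bA; have := card_setD_basis sC bA'.
have := subset_leq_card (_ : K \subset A' :&: C); rewrite subsetI sKA' sKC.
by rewrite (card_basis bA' bA) => /(_ isT); lia.
Qed.

Lemma basis_delete_dual C A B : C \subset ground M -> basis M A ->
  relative_basis C B -> B \subset A -> basis (delete (dual M) C) (ground M :\: C :\: A).
Proof.
move=> sC bA rB sBA; apply/basisP; split; first by apply/delete_dual_indepP; exists A.
move=> J /delete_dual_indepP[A' bA' /subset_leq_card leJ]; apply: leq_trans leJ _.
have [iA' _] := basisP _ _ bA'.
have := card_relative_basis rB (indep_sub (subsetIl A' C) iA') (subsetIr A' C).
have := subset_leq_card (_ : B \subset A :&: C).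
have /maxsetP[/andP[_ sBC] _] := rB; rewrite subsetI sBA sBC => /(_ isT).
have := card_setD_basis sC bA; have := card_setD_basis sC bA'.
by rewrite (card_basis bA' bA); lia.
Qed.

Lemma contract_indepP C I : C \subset ground M ->
  reflect (I \subset ground M :\: C /\
           exists2 B, relative_basis C B & indep M (I :|: B))
          (indep (contract M C) I).
Proof.
move=> sC; apply: (iffP andP) => -[sI].
  move=> /existsP[J /andP[bJ dIJ]]; split=> //.
  have [/delete_dual_indepP[A bA sJA] maxJ] := basisP _ _ bJ; have [iA _] := basisP _ _ bA.
  have eJ : J = ground M :\: C :\: A.
    by apply/eqP; rewrite eqEcard sJA; apply: maxJ; apply/delete_dual_indepP; exists A.
  rewrite eJ in bJ dIJ.
  exists (A :&: C); first exact: relative_basis_setI bJ.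
  apply: indep_sub iA; rewrite subUset subsetIl andbT; apply/subsetP => x xI.
  by have := disjointFr dIJ xI; rewrite inE (subsetP sI) // andbT => /negbFE.
case=> B rB iIB; have [A bA sIBA] := maxset_exists iIB.
have [sIA sBA] : I \subset A /\ B \subset A.
  by move: sIBA; rewrite subUset => /andP.
split=> //; apply/existsP; exists (ground M :\: C :\: A); apply/andP; split.
  exact: basis_delete_dual rB sBA.
rewrite disjoint_sym disjoints_subset; apply/subsetP => x; rewrite !inE.
by move=> /andP[xA _]; apply: contra xA => /(subsetP sIA).
Qed.

(* Meaningful only on sets disjoint from [C]. *)
Definition contract_cycles Z C : pred {set T} :=
  fun X => [exists Y : {set T}, (Y \subset C) && Z (X :|: Y)].

Lemma contract_cycles1 Z e X :
  contract_cycles Z [set e] X = Z X || Z (e |: X).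
Proof.
apply/existsP/orP => [[Y /andP[]]|[zX|zX]].
- by rewrite subset1 => /orP[]/eqP->; rewrite ?setU0; [right; rewrite setUC | left].
- by exists set0; rewrite sub0set setU0.
- by exists [set e]; rewrite subxx setUC.
Qed.

Lemma contract_cyclesU Z A B X :
  contract_cycles Z (A :|: B) X = contract_cycles (contract_cycles Z A) B X.
Proof.
apply/existsP/existsP => [[Y /andP[sY zY]]|[Y /andP[sYB /existsP[Y' /andP[sYA zY]]]]].
  exists (Y :&: B); rewrite subsetIr; apply/existsP; exists (Y :&: A).
  by rewrite subsetIr -setUA -setIUr [B :|: A]setUC (setIidPl sY).
by exists (Y' :|: Y); rewrite setUSS //= [Y' :|: Y]setUC setUA.
Qed.

Lemma relative_basis_cycle Z C B Y : cycle_space Z -> represented M Z ->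
  C \subset ground M -> relative_basis C B -> Y \subset C ->
  exists2 B' : {set T}, B' \subset B & Z (symdiff Y B').
Proof.
move=> [Z0 ZD] repM sC /maxsetP[/andP[iB sBC] maxB].
have [m] := ubnP #|Y :\: B|; elim: m Y => // m IH Y ltYm sYC.
have [YB0|[y]] := set_0Vmem (Y :\: B).
  exists Y; first by rewrite -setD_eq0 YB0.
  by rewrite (_ : symdiff Y Y = set0) //; apply/setP => x; rewrite !inE addbb.
rewrite inE => /andP[yB yY]; have yC := subsetP sYC y yY.
have syB : y |: B \subset C by rewrite subUset sub1set yC.
have [|S [sS zS yS]] := fundamental_cycle repM iB (subsetP sC y yC).
  by apply: contra yB => iyB; rewrite -(maxB (y |: B)) ?setU11 ?subsetUr // iyB.
have [||B' sB' zYSB'] := IH (symdiff Y S).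
- rewrite -ltnS; apply: leq_trans ltYm; rewrite (cardsD1 y (Y :\: B)) inE yB yY !ltnS.
  apply/subset_leq_card/subsetP => x; rewrite !inE => /andP[xB].
  have [->|xy] := eqVneq x y; first by rewrite yY yS.
  suff /negbTE-> : x \notin S by rewrite addbF => ->; rewrite xB.
  by apply/negP => /(subsetP sS); rewrite !inE (negbTE xy) (negbTE xB).
- exact: symdiff_subset sYC (subset_trans sS syB).
by exists B' => //; rewrite -(symdiffK S Y) symdiffAC; apply: ZD.
Qed.

Lemma represented_contract Z C : cycle_space Z -> C \subset ground M ->
  represented M Z -> represented (contract M C) (contract_cycles Z C).
Proof.
move=> cZ sC repM I; apply/(contract_indepP _ sC)/andP => -[sI].
  case=> B rB; rewrite repM => /andP[_ /cycle_freeP freeIB]; split=> //.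
  apply/cycle_freeP => S sSI /existsP[Y /andP[sYC zSY]].
  have [B' sB'B zYB'] := relative_basis_cycle cZ repM sC rB sYC.
  have zSB' : Z (S :|: B').
    have -> : S :|: B' = symdiff (S :|: Y) (symdiff Y B').
      have /maxsetP[/andP[_ sBC] _] := rB.
      apply/setP => x; rewrite !inE; case: (boolP (x \in S)) => [xS|_] /=; last first.
        by rewrite addKb.
      have := subsetP (subset_trans sSI sI) x xS; rewrite inE => /andP[xC _].
      rewrite (negbTE (contra (subsetP sYC x) xC)).
      by rewrite (negbTE (contra (subsetP (subset_trans sB'B sBC) x) xC)).
    by case: cZ => _; apply.
  apply/eqP; rewrite -subset0 -(freeIB _ _ zSB') ?subsetUl //.
  exact: setUSS sSI sB'B.
move=> /cycle_freeP freeI; split=> //; have [B rB] := relative_basis_exists C.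
have /maxsetP[/andP[iB sBC] _] := rB; exists B => //; rewrite repM subUset.
rewrite (subset_trans sI (subsetDl _ _)) (subset_trans sBC sC) /=.
apply/cycle_freeP => S sS zS.
have SDC0 : S :\: C = set0.
  apply: freeI; last by apply/existsP; exists (S :&: C); rewrite subsetIr setUC setID.
  by rewrite subDset setUC (subset_trans sS) // setUS.
move: iB; rewrite repM => /andP[_ /cycle_freeP]; apply=> //; apply/subsetP => x xS.
have xC : x \in C by apply/negPn/negP => xC; have := in_set0 x; rewrite -SDC0 inE xC xS.
have := subsetP sS x xS; rewrite inE => /orP[/(subsetP sI)|//].
by rewrite inE xC.
Qed.

End Contraction.

(** * Zero sums over GF(2) *)

Local Open Scope ring_scope.

Lemma F2_natr_eq0 n : (n%:R == 0 :> 'F_2) = ~~ odd n.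
Proof. by rewrite -(dvdn_pcharf (pchar_Fp (isT : prime 2))) dvdn2. Qed.

Lemma F2_natb (x : 'F_2) : x = (x != 0)%:R.
Proof. by have [->|/F2_neq0->] := eqVneq x 0. Qed.

Lemma F2_addr_neq0 (x y : 'F_2) : (x + y != 0) = (x != 0) (+) (y != 0).
Proof.
rewrite [x in x + y]F2_natb [y in _ + y]F2_natb -natrD F2_natr_eq0 negbK.
by case: (x != 0); case: (y != 0).
Qed.

Lemma F2_addrr (V : lmodType 'F_2) (x : V) : x + x = 0.
Proof. by rewrite -mulr2n -scaler_nat (_ : 2%:R = 0) ?scale0r //; apply: val_inj. Qed.

Lemma F2_addr_eq0 (V : lmodType 'F_2) (x y : V) : (x + y == 0) = (x == y).
Proof. by rewrite -(inj_eq (addIr y)) -addrA F2_addrr addr0 add0r. Qed.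

Section Supports.

Variables (R : nmodType) (m n : nat).

Definition row_supp (A : 'M[R]_(m, n)) : {set 'I_m} := [set i | row i A != 0].

Definition col_supp (A : 'M[R]_(m, n)) : {set 'I_n} := [set j | col j A != 0].

End Supports.

Lemma in_row_supp (R : nmodType) m (x : 'cV[R]_m) i : (i \in row_supp x) = (x i 0 != 0).
Proof.
rewrite inE; congr (~~ _); apply/eqP/eqP => [/rowP/(_ 0)|xi0]; first by rewrite !mxE.
by apply/rowP => j; rewrite ord1 !mxE.
Qed.

Lemma in_col_supp (R : nmodType) n (v : 'rV[R]_n) j : (j \in col_supp v) = (v 0 j != 0).
Proof.
rewrite inE; congr (~~ _); apply/eqP/eqP => [/colP/(_ 0)|vj0]; first by rewrite !mxE.
by apply/colP => i; rewrite ord1 !mxE.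
Qed.

Lemma col_supp0 (R : nmodType) m n : col_supp (0 : 'M[R]_(m, n)) = set0.
Proof. by apply/setP => j; rewrite !inE col0 eqxx. Qed.

Lemma row_suppD m (x y : 'cV['F_2]_m) : row_supp (x + y) = symdiff (row_supp x) (row_supp y).
Proof. by apply/setP => i; rewrite in_symdiff !in_row_supp mxE F2_addr_neq0. Qed.

Lemma col_suppD n (u v : 'rV['F_2]_n) : col_supp (u + v) = symdiff (col_supp u) (col_supp v).
Proof. by apply/setP => i; rewrite in_symdiff !in_col_supp mxE F2_addr_neq0. Qed.

Lemma odd_row_supp m (x : 'cV['F_2]_m) : odd #|row_supp x| = (\sum_a x a 0 != 0).
Proof.
rewrite -[LHS]negbK -F2_natr_eq0 -sum_mem natr_sum; congr (~~ (_ == _)).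
by apply: eq_bigr => a _; rewrite in_row_supp -F2_natb.
Qed.

Section ZeroSums.

Variable T : finType.
Implicit Types (S : {set T}) (e : T).

Definition zero_sum (V : lmodType 'F_2) (f : T -> V) : pred {set T} :=
  fun S => \sum_(e in S) f e == 0.

Lemma zero_sum_space (V : lmodType 'F_2) (f : T -> V) : cycle_space (zero_sum f).
Proof.
split=> [|A B /eqP zA /eqP zB]; rewrite /zero_sum ?big_set0 //.
have -> : \sum_(e in symdiff A B) f e = \sum_(e in A) f e + \sum_(e in B) f e.
  rewrite !(big_mkcond (fun e => e \in _)) -big_split; apply: eq_bigr => e _ /=.
  by rewrite in_symdiff; case: (e \in A); case: (e \in B); rewrite ?addr0 ?add0r ?F2_addrr.
by rewrite zA zB addr0.
Qed.

Lemma represented_vector (V : vectType 'F_2) (f : T -> V) S :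
  represented (vector_matroid f S) (zero_sum f).
Proof.
move=> I; congr (_ && _); apply/F2_free/cycle_freeP => indI X sXI; last first.
  by move=> zX; apply: indI => //; apply/eqP.
by move=> /eqP; apply: indI.
Qed.

Lemma zero_sum_setU1 (V : lmodType 'F_2) (f : T -> V) S e : e \notin S ->
  zero_sum f (e |: S) = (\sum_(x in S) f x == f e).
Proof. by move=> eS; rewrite /zero_sum big_setU1 //= F2_addr_eq0 eq_sym. Qed.

Lemma zero_sum_inj (V W : lmodType 'F_2) (phi : {additive V -> W}) (f : T -> V) S :
  injective phi -> zero_sum (phi \o f) S = zero_sum f S.
Proof. by move=> inj_phi; rewrite /zero_sum -raddf_sum raddf_eq0. Qed.

(* Contracting [e] projects along [f e]; the pivot [i] makes the projection explicit. *)
Lemma zero_sum_pivot p (f : T -> 'cV['F_2]_p) e i S : f e i 0 = 1 -> e \notin S ->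
  zero_sum (fun x => f x + f x i 0 *: f e) S = contract_cycles (zero_sum f) [set e] S.
Proof.
move=> fe1 eS; rewrite contract_cycles1 zero_sum_setU1 // /zero_sum big_split /=.
rewrite -scaler_suml -summxE; set s := \sum_(x in S) f x.
have [si0|/F2_neq0 si1] := eqVneq (s i 0) 0.
  rewrite si0 scale0r addr0; case: (eqVneq s (f e)) => [sfe|_]; last by rewrite orbF.
  by move/eqP: si0; rewrite sfe fe1 oner_eq0.
rewrite si1 scale1r F2_addr_eq0; case: (eqVneq s 0) => // s0.
by move/eqP: si1; rewrite s0 mxE eq_sym oner_eq0.
Qed.

Definition meets_evenly S (R : {set T}) := ~~ odd #|S :&: R|.

Lemma meets_evenlyC S R : meets_evenly S R = meets_evenly R S.
Proof. by rewrite /meets_evenly setIC. Qed.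

Definition coord_supp p (f : T -> 'cV['F_2]_p) i := [set e | f e i 0 != 0].

Lemma sum_mem_eq0 S (R : {set T}) :
  (\sum_(e in S) (e \in R)%:R == 0 :> 'F_2) = meets_evenly S R.
Proof.
by rewrite -natr_sum F2_natr_eq0 sum_mem_in.
Qed.

Lemma zero_sumE p (f : T -> 'cV['F_2]_p) S :
  zero_sum f S = [forall i, meets_evenly S (coord_supp f i)].
Proof.
have coordE i : meets_evenly S (coord_supp f i) = ((\sum_(e in S) f e) i 0 == 0).
  rewrite summxE -sum_mem_eq0; congr (_ == _); apply: eq_bigr => e _.
  by rewrite [RHS]F2_natb inE.
apply/eqP/forallP => [S0 i|even]; first by rewrite coordE S0 mxE.
by apply/colP => i; rewrite [RHS]mxE; apply/eqP; rewrite -coordE.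
Qed.

Lemma zero_sum_col_mx p q (f : T -> 'cV['F_2]_p) (g : T -> 'cV['F_2]_q) S :
  zero_sum (fun e => col_mx (f e) (g e)) S = zero_sum f S && zero_sum g S.
Proof.
rewrite -col_mx_eq0; congr (_ == _).
by elim/big_rec3: _ => [|e x y z _ ->]; rewrite ?col_mx0 ?add_col_mx.
Qed.

Definition membership_col (rs : seq {set T}) e : 'cV['F_2]_(size rs) :=
  \col_k (e \in nth set0 rs k)%:R.

Lemma coord_supp_membership_col rs k : coord_supp (membership_col rs) k = nth set0 rs k.
Proof. by apply/setP => e; rewrite inE mxE F2_natr_eq0; case: (e \in _). Qed.

Lemma zero_sum_membership_col rs S :
  zero_sum (membership_col rs) S = all (meets_evenly S) rs.
Proof.
rewrite zero_sumE; apply/forallP/(all_nthP set0) => even i.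
  by move=> ltis; have := even (Ordinal ltis); rewrite coord_supp_membership_col.
by rewrite coord_supp_membership_col even.
Qed.

Lemma card_row_supp_membership_col rs e :
  #|row_supp (membership_col rs e)| = count (fun R : {set T} => e \in R) rs.
Proof.
rewrite -sum1_card -sum1_count (big_nth set0) big_mkord; apply: eq_bigl => k.
by rewrite in_row_supp mxE F2_natr_eq0; case: (e \in _).
Qed.

Lemma membership_col_eq0 rs e :
  (membership_col rs e == 0) = ~~ has (fun R : {set T} => e \in R) rs.
Proof.
rewrite has_count -card_row_supp_membership_col card_gt0 negbK.
apply/eqP/eqP => [->|/setP supp0].
  by apply/setP => i; rewrite in_row_supp mxE eqxx inE.
by apply/colP => i; rewrite [RHS]mxE; apply/eqP/negbFE; rewrite -in_row_supp supp0 inE.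
Qed.

End ZeroSums.

Lemma zero_sum_imset (T U : finType) (V : lmodType 'F_2) (f : T -> V) (h : U -> T)
    (S : {set U}) : injective h -> zero_sum f (h @: S) = zero_sum (f \o h) S.
Proof. by move=> inj_h; rewrite /zero_sum big_imset //= => x y _ _ /inj_h. Qed.

(** * Blocking representations *)

Section BlockingVectors.

Variables k n : nat.
Implicit Types x : 'cV['F_2]_(k + n).

Definition blocking_vector x : bool := (#|row_supp (dsubmx x)| <= (usubmx x == 0%R).+1)%N.

Lemma blocking_vector0 : blocking_vector 0.
Proof.
rewrite /blocking_vector !linear0 eqxx (eq_card0 (A := row_supp _)) //.
by move=> i; rewrite in_row_supp mxE eqxx.
Qed.

Lemma blocking_vector_upper x i : blocking_vector x -> x (lshift n i) 0 != 0 ->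
  (#|row_supp (dsubmx x)| <= 1)%N.
Proof.
rewrite /blocking_vector; case: eqP => // /colP/(_ i); rewrite !mxE => ->.
by rewrite eqxx.
Qed.

Lemma blocking_vector_pivot x0 : blocking_vector x0 -> x0 != 0 ->
  exists2 i, x0 i 0 = 1 & forall x, blocking_vector x -> blocking_vector (x + x i 0 *: x0).
Proof.
rewrite /blocking_vector => b0 nx0; have [d0|/cV0Pn[i /F2_neq0 di]] := eqVneq (dsubmx x0) 0.
  have /cV0Pn[i /F2_neq0 ui] : usubmx x0 != 0.
    by apply: contraNneq nx0 => u0; rewrite -[x0]vsubmxK u0 d0 col_mx0.
  exists (lshift n i) => [|x bx]; first by rewrite mxE in ui.
  rewrite !linearD !linearZ /= d0 scaler0 addr0.
  have [u0|nu] := eqVneq (usubmx x) 0; last first.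
    by apply: leq_trans bx _; rewrite (negbTE nu).
  have -> : x (lshift n i) 0 = usubmx x i 0 by rewrite mxE.
  by move: bx; rewrite u0 mxE scale0r addr0 eqxx.
exists (rshift k i) => [|x bx]; first by rewrite mxE in di.
have [->|/F2_neq0 xi] := eqVneq (x (rshift k i) 0) 0; first by rewrite scale0r addr0.
rewrite xi scale1r !linearD row_suppD /=.
have [i0 ix] : i \in row_supp (dsubmx x0) /\ i \in row_supp (dsubmx x).
  by rewrite !in_row_supp di mxE xi.
have := card_symdiff (row_supp (dsubmx x)) (row_supp (dsubmx x0)).
have : (0 < #|row_supp (dsubmx x) :&: row_supp (dsubmx x0)|)%N.
  by apply/card_gt0P; exists i; rewrite inE ix.
case: (eqVneq (usubmx x0) 0) b0 => [->|_] b0; last first.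
  by move: b0 bx; do 2!case: (_ == 0) => /=; lia.
by move: b0 bx; rewrite addr0; case: (_ == 0) => /=; lia.
Qed.

End BlockingVectors.

Section BlockingRepresentations.

Variable T : finType.
Implicit Types (E C S : {set T}) (Z : pred {set T}).

Definition blocking_representable E Z := exists n (g : T -> 'cV['F_2]_(2 + n)),
  {in E, forall e, blocking_vector (g e)} /\
  forall S, S \subset E -> zero_sum g S = Z S.

Lemma blocking_representableS E1 E2 Z1 Z2 : E2 \subset E1 ->
  (forall S, S \subset E2 -> Z1 S = Z2 S) ->
  blocking_representable E1 Z1 -> blocking_representable E2 Z2.
Proof.
move=> sE eqZ [n [g [bg gZ]]]; exists n, g; split=> [e /(subsetP sE)/bg //|S sS].
by rewrite gZ ?eqZ // (subset_trans sS).
Qed.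

Lemma blocking_representable_contract1 E Z c : c \in E ->
  blocking_representable E Z ->
  blocking_representable (E :\ c) (contract_cycles Z [set c]).
Proof.
move=> cE [n [g [bg gZ]]].
have gZc S : S \subset E :\ c ->
    contract_cycles (zero_sum g) [set c] S = contract_cycles Z [set c] S.
  rewrite subsetD1 => /andP[sS _].
  by rewrite !contract_cycles1 !gZ // subUset sub1set cE.
have [gc0|gcn] := eqVneq (g c) 0.
  exists n, g; split=> [e /setD1P[_ /bg]//|S sS].
  rewrite -gZc // contract_cycles1 zero_sum_setU1 ?gc0 ?orbb //.
  by move: sS; rewrite subsetD1 => /andP[].
have [i gci bpivot] := blocking_vector_pivot (bg c cE) gcn.
exists n, (fun e => g e + g e i 0 *: g c); split=> [e /setD1P[_ /bg/bpivot]//|S sS].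
by rewrite -gZc // zero_sum_pivot //; move: sS; rewrite subsetD1 => /andP[].
Qed.

Lemma blocking_representable_contract E Z C : C \subset E ->
  blocking_representable E Z ->
  blocking_representable (E :\: C) (contract_cycles Z C).
Proof.
have [m] := ubnP #|C|; elim: m C E Z => // m IH C E Z ltCm sCE brZ.
have [->|[c cC]] := set_0Vmem C.
  apply: blocking_representableS brZ => [|S _]; first by rewrite setD0.
  apply/idP/existsP => [zS|[Y]]; first by exists set0; rewrite sub0set setU0.
  by rewrite subset0 => /andP[/eqP->]; rewrite setU0.
apply: (@blocking_representableS (E :\ c :\: (C :\ c)) _
          (contract_cycles (contract_cycles Z [set c]) (C :\ c))) => [|S _|].
- by rewrite setDDl setD1K.
- by rewrite -contract_cyclesU setD1K.
apply: IH; last exact: blocking_representable_contract1 (subsetP sCE c cC) brZ.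
  by move: ltCm; rewrite (cardsD1 c) cC.
exact: setSD.
Qed.

Lemma blocking_representable_rows E Z upper lower : size upper = 2 ->
  {in E, forall e, count (fun R : {set T} => e \in R) lower <=
                   (~~ has (fun R : {set T} => e \in R) upper).+1}%N ->
  (forall S, S \subset E -> Z S = all (meets_evenly S) (upper ++ lower)) ->
  blocking_representable E Z.
Proof.
case: upper => [|P [|Q []]] // _ few ZE; exists (size lower).
exists (fun e => col_mx (membership_col [:: P; Q] e) (membership_col lower e)).
split=> [e eE|S sS]; last first.
  rewrite ZE // all_cat zero_sum_col_mx (zero_sum_membership_col [:: P; Q]).
  by rewrite zero_sum_membership_col.
rewrite /blocking_vector col_mxKd col_mxKu card_row_supp_membership_col.
by rewrite (membership_col_eq0 [:: P; Q]) few.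
Qed.

End BlockingRepresentations.

(** * Signed graphs with a blocking pair *)

Section Stars.

Variable G : graph.
Implicit Types (W S : {set edge G}) (e : edge G) (u v x : vertex G).

Lemma in_star x e : (e \in star x) = (x \in ends e) && (#|ends e| == 2).
Proof. by rewrite inE mxE !enum_rankK F2_natr_eq0; case: (_ && _). Qed.

Lemma coord_supp_inc_col x : coord_supp (@inc_col G) (enum_rank x) = star x.
Proof. by apply/setP => e; rewrite !inE mxE. Qed.

Lemma zero_sum_inc_col S : zero_sum (@inc_col G) S = [forall x, meets_evenly S (star x)].
Proof.
rewrite zero_sumE; apply/forallP/forallP => even x; first by rewrite -coord_supp_inc_col.
by rewrite -(enum_valK x) coord_supp_inc_col.
Qed.

Lemma represented_cycle_matroid : represented (cycle_matroid G) (zero_sum (@inc_col G)).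
Proof.
move=> I; rewrite subsetT /= acyclicE; have := represented_vector (@inc_col G) setT I.
by rewrite /= /vector_indep !subsetT.
Qed.

Lemma even_sum_stars S : ~~ odd (\sum_x #|S :&: star x|).
Proof.
have -> : (\sum_x #|S :&: star x| = \sum_(e in S) \sum_x (e \in star x))%N.
  by rewrite exchange_big; apply: eq_bigr => x _; rewrite sum_mem_in.
rewrite odd_sum big1 // => e _.
under eq_bigr => x _ do rewrite in_star.
have [e2|_] := eqVneq #|ends e| 2; last by rewrite big1 // => x _; rewrite andbF.
by under eq_bigr => x _ do rewrite andbT; rewrite sum_mem e2.
Qed.

(* Every edge that is not a loop lies in exactly two stars. *)
Lemma meets_evenly_stars u S : (forall x, x != u -> meets_evenly S (star x)) ->
  forall x, meets_evenly S (star x).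
Proof.
move=> even x; have [->|/even//] := eqVneq x u.
have := even_sum_stars S; rewrite odd_sum (bigD1 u) //= big1 => [|y /even/negbTE//].
by rewrite addbF.
Qed.

Definition even_cycle_col W e := col (enum_rank e) (col_mx (char_row W) (incidence_mx G)).

Lemma represented_even_cycle W :
  represented (even_cycle_matroid W) (zero_sum (even_cycle_col W)).
Proof. exact: represented_vector. Qed.

Lemma zero_sum_even_cycle_col W S :
  zero_sum (even_cycle_col W) S =
  meets_evenly S W && [forall x, meets_evenly S (star x)].
Proof.
rewrite -zero_sum_inc_col -sum_mem_eq0.
have -> : zero_sum (even_cycle_col W) S =
    zero_sum (fun e => col_mx (col (enum_rank e) (char_row W)) (inc_col e)) S.
  by congr (_ == 0); apply: eq_bigr => e _; rewrite /even_cycle_col col_col_mx.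
have coordW i : coord_supp (fun e => col (enum_rank e) (char_row W)) i = W.
  by apply/setP => e; rewrite inE !mxE enum_rankK F2_natr_eq0; case: (e \in W).
rewrite zero_sum_col_mx zero_sumE sum_mem_eq0; congr (_ && _).
by apply/forallP/idP => [/(_ 0)|even i]; rewrite coordW.
Qed.

Lemma resignE W u : resign W u = symdiff W (star u).
Proof. by apply/setP => e; rewrite !inE; case: (e \in W); case: (_ != 0). Qed.

Lemma zero_sum_resign W u S :
  zero_sum (even_cycle_col (resign W u)) S = zero_sum (even_cycle_col W) S.
Proof.
rewrite !zero_sum_even_cycle_col; case: forallP => [even|_]; rewrite ?andbF // !andbT.
rewrite /meets_evenly resignE setI_symdiff odd_card_symdiff.
by rewrite (negbTE (even u)) addbF.
Qed.

Lemma zero_sum_resigns W us S :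
  zero_sum (even_cycle_col (foldl (@resign G) W us)) S = zero_sum (even_cycle_col W) S.
Proof. by elim: us W => //= u us IH W; rewrite IH zero_sum_resign. Qed.

Lemma blocking_representable_even_cycle W u v : u != v ->
  (forall e, e \in W -> (u \in ends e) || (v \in ends e)) ->
  blocking_representable setT (zero_sum (even_cycle_col W)).
Proof.
move=> nuv blockW; pose away := ~: [set u; v].
apply: (@blocking_representable_rows _ _ _ [:: W; star v] [seq star x | x in away]) => //.
  move=> e _; have starsE : (count (fun R : {set edge G} => e \in R) [seq star x | x in away] <=
                             #|ends e :\: [set u; v]|)%N.
    rewrite count_map -size_filter -(card_uniqP (filter_uniq _ (enum_uniq _))).
    apply/subset_leq_card/subsetP => x; rewrite mem_filter mem_enum /= in_star.
    by rewrite in_setC in_setD => /andP[/andP[-> _] ->].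
  apply: leq_trans starsE _; have /andP[_ le2] := ends_card e.
  have := cardsID [set u; v] (ends e); case: hasP => [[R RP eR]|_] /=; last by lia.
  suff : (0 < #|ends e :&: [set u; v]|)%N by lia.
  apply/card_gt0P; move: RP eR; rewrite !inE => /orP[]/eqP-> => [/blockW/orP[]|].
  - by exists u; rewrite !inE eqxx andbT.
  - by exists v; rewrite !inE eqxx orbT andbT.
  - by rewrite in_star => /andP[ve _]; exists v; rewrite !inE eqxx orbT andbT.
move=> S _; rewrite zero_sum_even_cycle_col /= all_map; congr (_ && _).
apply/forallP/andP => [even|[evenv /allP even]].
  by split=> //; apply/allP => x _; apply: even.
apply: (@meets_evenly_stars u) => x nxu; have [->//|nxv] := eqVneq x v.
by apply: even; rewrite mem_enum !inE negb_or nxu.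
Qed.

End Stars.

(* The vertex [u] is [None] and [v] is [Some None]: coordinate [0] lists the odd edges,
   and the other coordinates are the stars of the vertices other than [u]. *)
Section BlockingGraph.

Variables (E : finType) (n : nat) (g : E -> 'cV['F_2]_(2 + n)).
Hypothesis blocking_g : forall e, blocking_vector (g e).

Local Notation V := (option (option 'I_n)).

Definition star_coord (y : option 'I_n) : 'I_(2 + n) :=
  if y is Some i then rshift 2 i else lshift n 1.

Lemma star_coord_onto i : i != lshift n 0 -> exists y, i = star_coord y.
Proof.
case: (split_ordP i) => [[[|[|?]] ?]|j] -> // ni; last by exists (Some j).
by exists None; apply: val_inj.
Qed.

Definition nonroot_ends e : {set option 'I_n} := [set y | g e (star_coord y) 0 != 0].

Lemma card_nonroot_ends e :
  #|nonroot_ends e| = (#|row_supp (dsubmx (g e))| + (g e (lshift n 1) 0 != 0)%R)%N.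
Proof.
rewrite (cardsD1 None) inE addnC; congr (_ + _)%N.
rewrite -[RHS](card_imset _ (@Some_inj _)); apply: eq_card => -[i|]; rewrite !inE /=.
  by rewrite (mem_imset _ _ (@Some_inj _)) in_row_supp mxE.
by apply/esym/imsetP => -[].
Qed.

Lemma card_nonroot_ends_leq2 e : (#|nonroot_ends e| <= 2)%N.
Proof.
rewrite card_nonroot_ends; case: (boolP (_ != 0)) => [ge1|_].
  by rewrite addn1 ltnS (blocking_vector_upper (blocking_g e) ge1).
by rewrite addn0 (leq_trans (blocking_g e)) // ltnS leq_b1.
Qed.

Definition blocking_ends e : {set V} :=
  if #|nonroot_ends e| == 2 then Some @: nonroot_ends e else None |: Some @: nonroot_ends e.

Lemma card_blocking_ends e :
  #|blocking_ends e| = if #|nonroot_ends e| == 2 then 2 else #|nonroot_ends e|.+1.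
Proof.
rewrite /blocking_ends; case: ifP => [/eqP<-|_]; first exact: card_imset (@Some_inj _).
by rewrite cardsU1 (card_imset _ (@Some_inj _)) (_ : None \notin _) //; apply/imsetP => -[].
Qed.

Lemma blocking_ends_card e : (0 < #|blocking_ends e| <= 2)%N.
Proof.
rewrite card_blocking_ends; have := card_nonroot_ends_leq2 e.
by case: #|_| => [|[|[]]].
Qed.

Definition blocking_graph : graph := Graph blocking_ends_card.

Definition blocking_signature : {set edge blocking_graph} := coord_supp g (lshift n 0).

Lemma star_blocking_graph y :
  @star blocking_graph (Some y) = coord_supp g (star_coord y).
Proof.
apply/setP => e; rewrite in_star [RHS]inE /= card_blocking_ends /blocking_ends.
have memE : (Some y \in Some @: nonroot_ends e) = (g e (star_coord y) 0 != 0).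
  by rewrite (mem_imset _ _ (@Some_inj _)) inE.
case: ifPn => [_|ne2]; rewrite ?in_setU1 /= memE ?andbT //.
case: (boolP (_ != 0)) => //= gey; have := card_nonroot_ends_leq2 e.
have : (0 < #|nonroot_ends e|)%N by apply/card_gt0P; exists y; rewrite inE.
by case: #|_| ne2 => [|[|[]]].
Qed.

Lemma zero_sum_blocking_graph (S : {set edge blocking_graph}) :
  zero_sum (even_cycle_col blocking_signature) S = zero_sum g S.
Proof.
rewrite zero_sum_even_cycle_col zero_sumE.
apply/andP/forallP => [[evenW /forallP even] i|even].
  have [->//|/star_coord_onto[y ->]] := eqVneq i (lshift n 0).
  by rewrite -star_blocking_graph.
split; first exact: even.
apply/forallP; apply: (@meets_evenly_stars _ (None : vertex blocking_graph)).
by case=> // y _; rewrite star_blocking_graph even.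
Qed.

Lemma blocking_pair_blocking_graph :
  @blocking_pair blocking_graph blocking_signature None (Some None).
Proof.
split=> //; exists [::] => e; rewrite inE /= /blocking_ends => ge0.
case: ifPn => [/eqP e2|_]; last by rewrite setU11.
rewrite (mem_imset _ _ (@Some_inj _)) inE /=.
move: (blocking_vector_upper (blocking_g e) ge0); rewrite card_nonroot_ends in e2.
by case: (g e _ 0 != 0) e2; rewrite ?orbT // addn0 => ->.
Qed.

End BlockingGraph.

(** * Even-cycle matroids with a blocking pair *)

Lemma imset_preimset (T U : finType) (h : U -> T) (I : {set U}) (S : {set T}) :
  S \subset h @: I -> h @: (h @^-1: S) = S.
Proof.
move=> sS; apply/setP => x; apply/imsetP/idP => [[y]|xS]; first by rewrite inE => yS ->.
by have /imsetP[y _ xy] := subsetP sS x xS; exists y; rewrite // inE -xy.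
Qed.

Lemma imset_val_setT (T : finType) (A : {set T}) : val @: [set: {x | x \in A}] = A.
Proof.
apply/setP => x; apply/imsetP/idP => [[y _ ->]|xA]; first exact: (valP y).
by exists (exist _ x xA).
Qed.

Lemma imset_val_sub (T : finType) (A : {set T}) (I : {set {x | x \in A}}) : val @: I \subset A.
Proof. by apply/subsetP => _ /imsetP[x _ ->]; apply: valP. Qed.

Lemma cycle_free_imset (T U : finType) (Z : pred {set T}) (h : U -> T) (I : {set U}) :
  injective h -> cycle_free Z (h @: I) = cycle_free (fun S : {set U} => Z (h @: S)) I.
Proof.
move=> inj_h; apply/cycle_freeP/cycle_freeP => freeI S sSI zS.
  by have /eqP := freeI _ (imsetS h sSI) zS; rewrite imset_eq0 => /eqP.
have SE := imset_preimset sSI; rewrite -SE (freeI (h @^-1: S)) ?imset0 ?SE //.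
by apply/subsetP => y; rewrite inE => /(subsetP sSI); rewrite mem_imset.
Qed.

Section Isomorphism.

Variables (T U : finType) (M : matroid T) (N : matroid U).
Variables (ZM : pred {set T}) (ZN : pred {set U}) (f : {x | x \in ground M} -> U).
Hypotheses (inj_f : injective f) (onto_f : f @: setT = ground N).
Hypothesis eq_cycles : forall S : {set {x | x \in ground M}}, ZM (val @: S) = ZN (f @: S).
Hypothesis repN : represented N ZN.

Lemma indep_imset_represented (I : {set {x | x \in ground M}}) :
  indep N (f @: I) = cycle_free ZM (val @: I).
Proof.
rewrite repN -onto_f imsetS ?subsetT // !cycle_free_imset //; last exact: val_inj.
by apply: eq_cycle_free => S _; rewrite eq_cycles.
Qed.

Lemma represented_iso :
  (forall I : {set {x | x \in ground M}}, indep M (val @: I) = indep N (f @: I)) ->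
  represented M ZM.
Proof.
move=> isoM I; case: (boolP (I \subset ground M)) => sI /=; last first.
  by apply/negbTE; apply: contra sI; apply: indep_ground.
have <- := @imset_preimset _ _ val [set: {x | x \in ground M}] I.
  by rewrite isoM indep_imset_represented.
by rewrite imset_val_setT.
Qed.

Lemma matroid_iso_represented : represented M ZM -> matroid_iso M N.
Proof.
move=> repM; exists f; split=> // I; rewrite indep_imset_represented repM.
by rewrite imset_val_sub.
Qed.

End Isomorphism.

Section BlockingRepresentability.

Variables (T : finType) (M : matroid T) (Z : pred {set T}).
Hypothesis repM : represented M Z.

Lemma blocking_representable_of_even_cycle : cycle_space Z ->
  even_cycle_with_blocking_pair M -> blocking_representable (ground M) Z.
Proof.
move=> cZ [G [W [[f [inj_f onto_f isoM]] [u [v [nuv [us block]]]]]]].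
have [n [g [bg gW]]] := blocking_representable_even_cycle nuv block.
pose gM (x : T) := if insub x is Some y then g (f y) else 0.
exists n, gM; split=> [e eM|S sS]; first by rewrite /gM insubT bg ?inE.
apply: represented_uniq sS; rewrite //; first exact: zero_sum_space.
apply: represented_iso (represented_even_cycle W) isoM => // X.
rewrite -(zero_sum_resigns W us) -gW ?subsetT // !zero_sum_imset //; last exact: val_inj.
by congr (_ == 0); apply: eq_bigr => x _; rewrite /= /gM valK.
Qed.

Lemma even_cycle_of_blocking_representable :
  blocking_representable (ground M) Z -> even_cycle_with_blocking_pair M.
Proof.
move=> [n [g [bg gZ]]].
have bgM (e : {x | x \in ground M}) : blocking_vector (g (val e)) by apply/bg/valP.
exists (blocking_graph bgM), (blocking_signature bgM); split; last first.
  by exists None, (Some None); apply: blocking_pair_blocking_graph.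
have repN := represented_even_cycle (blocking_signature bgM).
apply: (@matroid_iso_represented _ _ _ _ _ _ id _ _ _ repN repM) => //.
  by rewrite imset_id.
move=> S; rewrite imset_id zero_sum_blocking_graph -gZ ?imset_val_sub //.
by rewrite zero_sum_imset //; apply: val_inj.
Qed.

End BlockingRepresentability.

Lemma excluded_minor_blocking (T : finType) (M : matroid T) (Z : pred {set T}) :
  cycle_space Z -> represented M Z -> ~ blocking_representable (ground M) Z ->
  {in ground M, forall e, blocking_representable (ground M :\ e) Z} ->
  {in ground M, forall e,
    blocking_representable (ground M :\ e) (contract_cycles Z [set e])} ->
  excluded_minor even_cycle_with_blocking_pair M.
Proof.
move=> cZ repM nbM bdelete bcontract; split.
  by move=> /(blocking_representable_of_even_cycle repM cZ).
move=> C D sC sD dCD nCD.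
apply: (even_cycle_of_blocking_representable
          (represented_delete D (represented_contract cZ sC repM))) => /=.
have /set0Pn[e] := nCD; rewrite inE => /orP[eC|eD].
  have sCe : C :\ e \subset ground M :\ e by rewrite setSD.
  apply: blocking_representableS (blocking_representable_contract sCe (bcontract e _)).
  - by rewrite (_ : _ :\: (C :\ e) = ground M :\: C) ?subsetDl // setDDl setD1K.
  - by move=> S _; rewrite -contract_cyclesU setD1K.
  - exact: subsetP sC e eC.
have eC : e \notin C by rewrite (disjointFl dCD eD).
have sCe : C \subset ground M :\ e by rewrite subsetD1 sC.
apply: blocking_representableS (blocking_representable_contract sCe (bdelete e _)) => //.
  by rewrite !setDDl setDS // setUC setUS ?sub1set.
exact: subsetP sD e eD.
Qed.

(** * Counting cocycles *)

Lemma card_F2_rows d : #|{: 'rV['F_2]_d}| = (2 ^ d)%N.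
Proof. by rewrite card_mx card_Fp // mul1n. Qed.

Lemma card_row_nonorthogonal d (c : 'cV['F_2]_d) : c != 0 ->
  (2 * #|[set v : 'rV['F_2]_d | ((v *m c) 0 0 != 0)%R]| = 2 ^ d)%N.
Proof.
move=> /cV0Pn[i /F2_neq0 ci]; set S := [set v | _].
pose shift (v : 'rV['F_2]_d) := v + delta_mx 0 i.
have shiftK : involutive shift by move=> v; rewrite /shift -addrA F2_addrr addr0.
have shiftS : shift @: S = ~: S.
  apply/setP => v; rewrite -{1}[v]shiftK (mem_imset _ _ (can_inj shiftK)) !inE.
  by rewrite mulmxDl -rowE [(_ + _ : 'M_1) 0 0]mxE [row i c 0 0]mxE ci F2_addr_neq0 addbT negbK.
rewrite -card_F2_rows -(cardsC S) -shiftS (card_imset _ (can_inj shiftK)).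
by rewrite mul2n addnn.
Qed.

Lemma col_mulmx (F : fieldType) m n p (A : 'M[F]_(m, n)) (B : 'M[F]_(n, p)) j :
  col j (A *m B) = A *m col j B.
Proof. by rewrite !colE mulmxA. Qed.

Lemma sum_card_col_supp d m (B : 'M['F_2]_(d, m)) :
  (2 * \sum_(v : 'rV['F_2]_d) #|col_supp (v *m B)| = 2 ^ d * #|col_supp B|)%N.
Proof.
have -> : (\sum_(v : 'rV['F_2]_d) #|col_supp (v *m B)| =
    \sum_j #|[set v : 'rV['F_2]_d | ((v *m col j B) 0 0 != 0)%R]|)%N.
  transitivity (\sum_(v : 'rV['F_2]_d) \sum_j (j \in col_supp (v *m B)))%N.
    by apply: eq_bigr => v _; rewrite sum_mem.
  rewrite exchange_big; apply: eq_bigr => j _; rewrite -sum_mem; apply: eq_bigr => v _.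
  by rewrite in_col_supp inE -col_mulmx [col _ _ _ _]mxE.
rewrite big_distrr mulnC -sum_nat_const /= [RHS]big_mkcond; apply: eq_bigr => j _ /=.
rewrite inE; case: eqP => [->|/eqP/card_row_nonorthogonal//].
rewrite (_ : [set v | _] = set0) ?cards0 //.
by apply/setP => v; rewrite !inE mulmx0 mxE eqxx.
Qed.

(* Averages the weight over the nonzero vectors of the row space of [Y]. *)
Lemma row_space_weight_bound p m (Y : 'M['F_2]_(p, m)) w :
  (forall v : 'rV_m, (v <= Y)%MS -> v != 0%R -> w <= #|col_supp v|)%N ->
  (2 * w * (2 ^ \rank Y - 1) <= 2 ^ \rank Y * #|col_supp Y|)%N.
Proof.
move=> wY; pose B := row_base Y.
have wB (v : 'rV_(\rank Y)) : v != 0 -> (w <= #|col_supp (v *m B)|)%N.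
  move=> nv; apply: wY; first by rewrite (submx_trans (submxMl _ _)) // eq_row_base.
  by apply: contra nv => /eqP vB; apply/eqP/(row_free_inj (row_base_free Y)); rewrite vB mul0mx.
have suppB : col_supp B \subset col_supp Y.
  apply/subsetP => j; rewrite !inE; apply: contra => /eqP Yj.
  have /submxP[X ->] : (B <= Y)%MS by rewrite eq_row_base.
  by rewrite col_mulmx Yj mulmx0.
apply: (@leq_trans (2 ^ \rank Y * #|col_supp B|)); last first.
  by rewrite leq_mul2l subset_leq_card ?orbT.
rewrite -sum_card_col_supp -mulnA leq_mul2l /= (bigD1 0) //=.
apply: leq_trans (leq_addl _ _).
apply: (@leq_trans (\sum_(v : 'rV['F_2]_(\rank Y) | v != 0%R) w)); last exact: leq_sum.
by rewrite sum_nat_const cardC1 card_F2_rows subn1 mulnC.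
Qed.

Section RootMatrix.

Variables (F : fieldType) (k n m : nat) (A : 'M[F]_(k + n, m)).

Definition root_star : 'rV[F]_m := const_mx 1 *m dsubmx A.

Definition root_mx : 'M[F]_(k + 1, m) := col_mx (usubmx A) root_star.

Lemma root_starE : root_star = \sum_a row a (dsubmx A).
Proof. by rewrite /root_star mulmx_sum_row; apply: eq_bigr => a _; rewrite mxE scale1r. Qed.

Lemma submx_usubmx_dsubmx : (usubmx A <= A)%MS /\ (dsubmx A <= A)%MS.
Proof. by apply/andP; rewrite -col_mx_sub vsubmxK. Qed.

Lemma root_mx_sub : (root_mx <= A)%MS.
Proof.
have [sU sD] := submx_usubmx_dsubmx.
by rewrite col_mx_sub sU (submx_trans (submxMl _ _)).
Qed.

Lemma root_star_sub : (root_star <= A)%MS.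
Proof. by apply: submx_trans root_mx_sub; rewrite -addsmxE addsmxSr. Qed.

Lemma col_supp_root_star : col_supp root_star \subset col_supp root_mx.
Proof.
apply/subsetP => j; rewrite !inE; apply: contra.
by rewrite col_col_mx col_mx_eq0 => /andP[].
Qed.

(* The root star is the sum of the lower rows, so one nonzero lower row is redundant. *)
Lemma rank_root_mx : (\rank A <= \rank root_mx + #|row_supp (dsubmx A)|.-1)%N.
Proof.
have [lower0|[b bsupp]] := set_0Vmem (row_supp (dsubmx A)).
  apply: leq_trans (mxrankS _) (leq_addr _ _); rewrite -[X in (X <= _)%MS]vsubmxK.
  rewrite col_mx_sub -addsmxE addsmxSl; apply/row_subP => a.
  by have := in_set0 a; rewrite -lower0 inE => /negbFE/eqP->; rewrite sub0mx.
pose others := (\sum_(a in row_supp (dsubmx A) :\ b) <<row a (dsubmx A)>>)%MS.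
have rank_others : (\rank others <= #|row_supp (dsubmx A)|.-1)%N.
  rewrite (cardsD1 b) bsupp /= -[leqRHS]sum1_card.
  apply: leq_trans (mxrank_sum_leqif _) _ => /=.
  by apply: leq_sum => a _; rewrite genmxE rank_leq_row.
apply: leq_trans (leq_trans (mxrankS _) (mxrank_adds_leqif root_mx others)) _; last first.
  by rewrite leq_add2l.
have /andP[sU sR] : (usubmx A <= root_mx)%MS && (root_star <= root_mx)%MS.
  by rewrite -col_mx_sub.
have sub_others a : a != b -> (row a (dsubmx A) <= root_mx + others)%MS.
  move=> ab; have [->|na] := eqVneq (row a (dsubmx A)) 0; first exact: sub0mx.
  apply: submx_trans (addsmxSr _ _); apply: (sumsmx_sup a); last by rewrite genmxE.
  by rewrite !inE ab.
rewrite -[X in (X <= _)%MS]vsubmxK col_mx_sub.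
rewrite (submx_trans sU) ?addsmxSl //; apply/row_subP => a.
have [->|/sub_others//] := eqVneq a b.
have -> : row b (dsubmx A) = root_star - \sum_(a | a != b) row a (dsubmx A).
  by rewrite root_starE (bigD1 b) //= addrK.
rewrite addmx_sub ?(submx_trans sR) ?addsmxSl // -scaleN1r scalemx_sub //.
by apply: summx_sub => c; apply: sub_others.
Qed.

End RootMatrix.

Section BlockingCount.

Variables (k n m : nat) (A : 'M['F_2]_(k + n, m)).

Lemma in_col_supp_root_star j :
  (j \in col_supp (root_star A)) = odd #|row_supp (dsubmx (col j A))|.
Proof.
rewrite in_col_supp odd_row_supp root_starE summxE; congr (_ != 0).
by apply: eq_bigr => a _; rewrite !mxE.
Qed.

Lemma in_col_supp_root_mx j :
  (j \in col_supp (root_mx A)) =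
  (usubmx (col j A) != 0) || odd #|row_supp (dsubmx (col j A))|.
Proof.
rewrite -in_col_supp_root_star !inE col_col_mx col_mx_eq0 negb_and; congr ((_ != 0) || _).
by apply/colP => i; rewrite !mxE.
Qed.

Lemma in_col_supp_blocking j :
  (j \in col_supp A) = (usubmx (col j A) != 0) || (0 < #|row_supp (dsubmx (col j A))|)%N.
Proof.
rewrite inE -{1}[col j A]vsubmxK col_mx_eq0 negb_and; congr (_ || _).
by apply/cV0Pn/card_gt0P => -[a]; rewrite ?in_row_supp => xa; exists a; rewrite ?in_row_supp.
Qed.

Hypothesis blocking_cols : forall j, blocking_vector (col j A).

Lemma blocking_col_count j :
  (#|row_supp (dsubmx (col j A))| + 2 * (j \in col_supp (root_mx A)) <=
   (j \in col_supp (root_star A)) + 2 * (j \in col_supp A))%N.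
Proof.
have := blocking_cols j; rewrite /blocking_vector in_col_supp_root_star.
rewrite in_col_supp_root_mx in_col_supp_blocking.
by case: (_ == 0) => /=; case: #|_| => [|[|[|c]]].
Qed.

Lemma sum_card_row_weights :
  (\sum_a #|col_supp (row a (dsubmx A))| = \sum_j #|row_supp (dsubmx (col j A))|)%N.
Proof.
under eq_bigr => a _ do rewrite -sum_mem.
rewrite exchange_big; apply: eq_bigr => j _; rewrite -sum_mem; apply: eq_bigr => a _.
by rewrite in_col_supp in_row_supp !mxE.
Qed.

Lemma sum_row_weights_bound :
  (\sum_a #|col_supp (row a (dsubmx A))| + 2 * #|col_supp (root_mx A)| <=
   #|col_supp (root_star A)| + 2 * #|col_supp A|)%N.
Proof.
rewrite sum_card_row_weights -!(@sum_mem 'I_m) !big_distrr /= -!big_split /=.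
by apply: leq_sum => j _; apply: blocking_col_count.
Qed.

Lemma blocking_bounds w :
  (forall v : 'rV_m, (v <= A)%MS -> v != 0%R -> w <= #|col_supp v|)%N ->
  let d := \rank (root_mx A) in
  let s := #|col_supp (root_mx A)| in
  exists l, [/\ (\rank A <= d + l.-1)%N,
    (w * l + 2 * s <= #|col_supp (root_star A)| + 2 * #|col_supp A|)%N
    & (2 * w * (2 ^ d - 1) <= 2 ^ d * s)%N].
Proof.
move=> wA d s; exists #|row_supp (dsubmx A)|; split; first exact: rank_root_mx.
  apply: leq_trans sum_row_weights_bound; rewrite leq_add2r mulnC -sum_nat_const.
  rewrite [leqRHS](bigID (mem (row_supp (dsubmx A)))) /=; apply: leq_trans (leq_addr _ _).
  have [_ sD] := submx_usubmx_dsubmx A.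
  by apply: leq_sum => a; rewrite inE; apply: wA; apply: submx_trans (row_sub _ _) sD.
apply: row_space_weight_bound => v sv; apply: wA; exact: submx_trans sv (root_mx_sub A).
Qed.

End BlockingCount.

(** * Cocycles and duality *)

Section Cocycles.

Variables (T : finType) (p : nat) (f : T -> 'cV['F_2]_p).
Implicit Types (B E I S X : {set T}) (l : 'rV['F_2]_p) (e : T).

Definition cocycle E l : {set T} := [set e in E | (l *m f e) 0 0 != 0].

Definition cocycles E : pred {set T} :=
  fun S => [exists l : 'rV['F_2]_p, S == cocycle E l].

Lemma cocycles_space E : cycle_space (cocycles E).
Proof.
split=> [|A B /existsP[a /eqP->] /existsP[b /eqP->]]; apply/existsP.
  by exists 0; apply/eqP/setP => e; rewrite !inE mul0mx mxE eqxx andbF.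
exists (a + b); apply/eqP/setP => e; rewrite !inE mulmxDl [(_ + _ : 'M_1) 0 0]mxE.
by rewrite F2_addr_neq0; case: (e \in E).
Qed.

Lemma zero_sum_cocycle_even E l X : X \subset E -> zero_sum f X -> meets_evenly X (cocycle E l).
Proof.
move=> /subsetP sXE /eqP X0; rewrite -sum_mem_eq0; apply/eqP.
transitivity ((l *m \sum_(e in X) f e) 0 0); last by rewrite X0 mulmx0 mxE.
by rewrite mulmx_sumr summxE; apply: eq_bigr => e /sXE eE; rewrite inE eE [RHS]F2_natb.
Qed.

Lemma coord_supp_cocycle i : coord_supp f i = cocycle setT (delta_mx 0 i).
Proof. by apply/setP => e; rewrite !inE -rowE mxE. Qed.

Variable M : matroid T.
Hypothesis repM : represented M (zero_sum f).

Lemma dependent_orthogonal B e l : indep M B -> e \in ground M -> ~~ indep M (e |: B) ->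
  (forall b, b \in B -> (l *m f b) 0 0 = 0) -> (l *m f e) 0 0 = 0.
Proof.
move=> iB eM depeB lB.
have [X [sX zX eX]] := fundamental_cycle repM iB eM depeB.
have : (l *m \sum_(x in X) f x) 0 0 = 0 by rewrite (eqP zX) mulmx0 mxE.
rewrite mulmx_sumr summxE (big_setD1 e) //= big1 ?addr0 // => x /setD1P[xe xX].
by have := subsetP sX x xX; rewrite in_setU1 (negbTE xe) => /lB.
Qed.

Lemma separating_functional B e : e \notin B -> indep M (e |: B) ->
  exists2 l : 'rV['F_2]_p, (l *m f e) 0 0 = 1 & forall b, b \in B -> (l *m f b) 0 0 = 0.
Proof.
move=> eB; rewrite repM => /andP[_ free_eB].
pose X : #|B|.+1.-tuple _ := [tuple of f e :: [seq f b | b <- enum B]].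
have freeX : free X.
  rewrite /= -free_setU1 //; apply/F2_free => S sS /eqP zS.
  by move/cycle_freeP: free_eB; apply.
pose l : 'rV_p := \row_i coord X 0 (delta_mx i 0).
have lE v : (l *m v) 0 0 = coord X 0 v.
  rewrite mxE {2}[v]matrix_sum_delta linear_sum; apply: eq_bigr => i _.
  by rewrite big_ord1 linearZ mxE mulrC.
exists l => [|b bB]; first by rewrite lE; exact: (coord_free 0 0 freeX).
have -> : f b = X`_(lift 0 (enum_rank_in bB b)).
  by rewrite lift0 /= (nth_map b) -?cardE // -enum_val_nth enum_rankK_in.
by rewrite lE coord_free.
Qed.

Lemma indep_dual_cocycle_free I : indep (dual M) I -> cycle_free (cocycles (ground M)) I.
Proof.
case/andP=> sI /existsP[B /andP[bB dIB]]; have [iB maxB] := basisP _ _ bB.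
apply/cycle_freeP => S sSI /existsP[l /eqP SE]; apply/eqP; rewrite -subset0.
apply/subsetP => e eS; have eB : e \notin B by rewrite (disjointFr dIB (subsetP sSI e eS)).
have := eS; rewrite SE inE => /andP[eM /eqP[]]; apply: (dependent_orthogonal iB eM).
  by apply/negP => /maxB; rewrite cardsU1 eB add1n ltnn.
move=> b bB'; have /negbTE bS : b \notin S.
  by apply: contraL bB' => /(subsetP sSI) bI; rewrite (disjointFr dIB bI).
by move: bS; rewrite SE inE (subsetP (indep_ground iB)) // => /eqP.
Qed.

Lemma cocycle_free_indep_dual I : I \subset ground M ->
  cycle_free (cocycles (ground M)) I -> indep (dual M) I.
Proof.
move=> sI /cycle_freeP freeI; apply/andP; split=> //.
have [B /maxsetP[/andP[iB sB] maxB]] := relative_basis_exists M (~: I).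
apply/existsP; exists B; rewrite disjoint_sym disjoints_subset sB andbT.
apply/basisP; split=> // J iJ; rewrite leqNgt; apply/negP => /(indep_aug iB iJ)[e].
rewrite inE => /andP[eB eJ] ieB; have [l le lB] := separating_functional eB ieB.
have eM : e \in ground M := subsetP (indep_ground iJ) e eJ.
suff /setP/(_ e) : cocycle (ground M) l = set0 by rewrite !inE eM le oner_eq0.
apply: freeI; last by apply/existsP; exists l.
apply/subsetP => h; rewrite inE => /andP[hM]; apply: contraR => hI; apply/eqP.
have [ihB|dephB] := boolP (indep M (h |: B)); last exact: dependent_orthogonal iB hM dephB lB.
apply: lB; rewrite -(maxB (h |: B)) ?setU11 ?subsetUr //.
by rewrite ihB subUset sub1set inE hI.
Qed.

Lemma represented_dual : represented (dual M) (cocycles (ground M)).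
Proof.
move=> I; apply/idP/andP => [iI|[sI]]; last exact: cocycle_free_indep_dual.
by split; [apply: (indep_ground iI) | apply: indep_dual_cocycle_free].
Qed.

End Cocycles.

Section RepresentationMatrix.

Variables (T : finType) (E : {set T}).
Implicit Types (X I : {set T}) (v : 'rV['F_2]_#|T|).

(* The row space is the cocycle space of the matroid represented by [g] on [E]. *)
Definition rep_mx p (g : T -> 'cV['F_2]_p) : 'M['F_2]_(p, #|T|) :=
  \matrix_(i, j) (if enum_val j \in E then g (enum_val j) i 0 else 0).

Definition ground_supp v : {set T} := [set e | v 0 (enum_rank e) != 0].

Lemma card_ground_supp v : #|ground_supp v| = #|col_supp v|.
Proof.
rewrite -[LHS](card_imset _ enum_rank_inj); apply: eq_card => j.
by rewrite -(enum_valK j) (mem_imset _ _ enum_rank_inj) inE in_col_supp.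
Qed.

Lemma col_rep_mx p (g : T -> 'cV['F_2]_p) j :
  col j (rep_mx g) = if enum_val j \in E then g (enum_val j) else 0.
Proof. by apply/colP => i; rewrite !mxE; case: ifP; rewrite ?mxE. Qed.

Lemma card_col_supp_rep_mx p (g : T -> 'cV['F_2]_p) : (#|col_supp (rep_mx g)| <= #|E|)%N.
Proof.
rewrite -[#|E|](card_imset _ enum_rank_inj); apply/subset_leq_card/subsetP => j.
rewrite -[j]enum_valK (mem_imset _ _ enum_rank_inj) inE col_rep_mx enum_rankK.
by case: ifP; rewrite ?eqxx.
Qed.

Lemma ground_supp_rep_mx p (g : T -> 'cV['F_2]_p) l : ground_supp (l *m rep_mx g) = cocycle g E l.
Proof.
apply/setP => e; rewrite !inE.
have -> : (l *m rep_mx g) 0 (enum_rank e) = (l *m col (enum_rank e) (rep_mx g)) 0 0.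
  by rewrite -col_mulmx [RHS]mxE.
by rewrite col_rep_mx enum_rankK; case: ifP; rewrite // mulmx0 mxE eqxx.
Qed.

Lemma rep_mx_mulmx p (g : T -> 'cV['F_2]_p) (c : 'cV['F_2]_#|T|) :
  rep_mx g *m c = \sum_(e in [set e in E | c (enum_rank e) 0 != 0]) g e.
Proof.
apply/colP => i; rewrite mxE summxE [RHS]big_mkcond (reindex enum_rank) /=; last first.
  by exists enum_val => e _; rewrite ?enum_valK ?enum_rankK.
apply: eq_bigr => e _; rewrite mxE enum_rankK inE; case: ifP => _; last by rewrite mul0r.
by rewrite [c _ _]F2_natb; case: (_ != 0); rewrite ?mulr1 ?mulr0.
Qed.

Lemma submx_rep_mx p q (f : T -> 'cV['F_2]_p) (g : T -> 'cV['F_2]_q) :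
  (forall X, X \subset E -> zero_sum f X -> zero_sum g X) -> (rep_mx g <= rep_mx f)%MS.
Proof.
move=> sub_fg; rewrite submxE; apply/eqP/matrixP => i j; rewrite [RHS]mxE.
have -> : (rep_mx g *m cokermx (rep_mx f)) i j =
          (rep_mx g *m col j (cokermx (rep_mx f))) i 0 by rewrite -col_mulmx [RHS]mxE.
rewrite rep_mx_mulmx; set X := [set e in E | _].
suff /eqP-> : zero_sum g X by rewrite mxE.
apply: sub_fg; first by apply/subsetP => e; rewrite inE => /andP[].
by rewrite /zero_sum -rep_mx_mulmx -col_mulmx mulmx_coker col0.
Qed.

Lemma eq_rep_mx p q (f : T -> 'cV['F_2]_p) (g : T -> 'cV['F_2]_q) :
  (forall X, X \subset E -> zero_sum f X = zero_sum g X) -> (rep_mx f :=: rep_mx g)%MS.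
Proof. by move=> eqfg; apply/eqmxP/andP; split; apply: submx_rep_mx => X /eqfg->. Qed.

Lemma rep_mx_orthogonal p (g : T -> 'cV['F_2]_p) v X :
  (v <= rep_mx g)%MS -> X \subset E -> zero_sum g X -> meets_evenly X (ground_supp v).
Proof. by move=> /submxP[l ->]; rewrite ground_supp_rep_mx; apply: zero_sum_cocycle_even. Qed.

Lemma rank_rep_mx p (g : T -> 'cV['F_2]_p) I :
  I \subset E -> cycle_free (zero_sum g) I -> (#|I| <= \rank (rep_mx g))%N.
Proof.
move=> sIE /cycle_freeP freeI; pose B := \matrix_(i < #|I|) (g (enum_val i))^T.
have sB : (B <= (rep_mx g)^T)%MS.
  apply/row_subP => i; rewrite rowK; apply: (eq_row_sub (enum_rank (enum_val i))).
  by rewrite -tr_col col_rep_mx enum_rankK (subsetP sIE) ?enum_valP.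
rewrite -mxrank_tr; apply: leq_trans (mxrankS sB).
suff /eqP-> : row_free B by [].
apply: inj_row_free => v vB; pose S := [set enum_val i | i in col_supp v].
have S0 : S = set0.
  apply: freeI; first by apply/subsetP => _ /imsetP[i _ ->]; apply: enum_valP.
  rewrite /zero_sum big_imset /= => [|i j _ _]; last exact: enum_val_inj.
  apply/eqP/trmx_inj; rewrite trmx0 -vB mulmx_sum_row linear_sum big_mkcond /=.
  apply: eq_bigr => i _; rewrite in_col_supp rowK.
  by rewrite [v 0 i in RHS]F2_natb; case: (_ != 0); rewrite ?scale1r ?scale0r.
apply/rowP => i; rewrite [RHS]mxE; apply/eqP/negbFE/negbTE; rewrite -in_col_supp.
by apply/negP => iv; have := in_set0 (enum_val i); rewrite -S0 imset_f.
Qed.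

End RepresentationMatrix.

Lemma blocking_rep_mx_bounds (T : finType) (E : {set T}) k n (g : T -> 'cV['F_2]_(k + n)) w :
  {in E, forall e, blocking_vector (g e)} ->
  let A := rep_mx E g in
  (forall v : 'rV_#|T|, (v <= A)%MS -> v != 0%R -> w <= #|col_supp v|)%N ->
  let d := \rank (root_mx A) in
  let s := #|col_supp (root_mx A)| in
  exists l, [/\ (\rank A <= d + l.-1)%N,
    (w * l + 2 * s <= #|col_supp (root_star A)| + 2 * #|E|)%N
    & (2 * w * (2 ^ d - 1) <= 2 ^ d * s)%N].
Proof.
move=> bg A wA d s; have [|l [rkA count avg]] := blocking_bounds _ wA.
  by move=> j; rewrite col_rep_mx; case: ifP => [/bg|_]; rewrite ?blocking_vector0.
exists l; split=> //; apply: leq_trans count _.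
by rewrite leq_add2l leq_mul2l card_col_supp_rep_mx.
Qed.

(** * PG(3,2) minus a line *)

Lemma unitmx_row_free (F : fieldType) m n (A B : 'M[F]_(m, n)) :
  row_free A -> row_free B -> exists2 P, P \in unitmx & A *m P = B.
Proof.
move=> freeA freeB; have AB : A *m (pinvmx A *m B) = B by rewrite mulmxA mulmxVp // mul1mx.
have [|P uP AP] := @complete_unitmx _ _ _ A (pinvmx A *m B); last by exists P; rewrite // -AP.
by rewrite AB; move: freeA freeB => /eqP-> /eqP->.
Qed.

Definition rows3 n (x y z : 'rV['F_2]_n) : 'M['F_2]_(3, n) :=
  \matrix_k nth 0 [:: x; y; z] k.

Lemma row_free_rows3 n (x y z : 'rV['F_2]_n) :
  x != 0 -> y != 0 -> x != y -> z \notin [:: 0; x; y; x + y] -> row_free (rows3 x y z).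
Proof.
rewrite !inE !negb_or => x0 y0 xy /and4P[z0 zx zy zxy]; apply: inj_row_free => u.
rewrite mulmx_sum_row !big_ord_recl big_ord0 !rowK addr0 /=.
set a := u 0 _; set b := u 0 _; set c := u 0 _ => uxyz.
suff [a0 b0 c0] : [/\ a = 0, b = 0 & c = 0].
  apply/rowP => i; rewrite [RHS]mxE; case: (unliftP ord0 i) => [j ->|-> //].
  case: (unliftP ord0 j) => [j' ->|-> //]; case: (unliftP ord0 j') => [[]|->] //.
move: uxyz; rewrite [a]F2_natb [b]F2_natb [c]F2_natb.
case: (a != 0); case: (b != 0); case: (c != 0); rewrite ?scale1r ?scale0r ?addr0 ?add0r //.
all: rewrite ?addrA => /eqP; rewrite ?F2_addr_eq0 ?(negbTE x0) ?(negbTE y0) ?(negbTE z0).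
all: by rewrite ?(negbTE xy) // eq_sym ?(negbTE zx) ?(negbTE zy) ?(negbTE zxy).
Qed.

Definition PG32_point (v : 'rV['F_2]_4) : 'cV['F_2]_(2 + 2) := v^T.

Lemma zero_sum_PG32_frame (P : 'M['F_2]_4) S : P \in unitmx ->
  zero_sum (fun v => PG32_point (v *m P)) S = zero_sum PG32_point S.
Proof.
move=> uP; rewrite -[RHS](@zero_sum_inj _ _ _ (mulmx P^T)); last first.
  by apply: can_inj (mulKmx _); rewrite unitmx_tr.
by congr (_ == 0); apply: eq_bigr => v _; rewrite /PG32_point trmx_mul.
Qed.

Lemma represented_PG32 : represented PG32 (zero_sum PG32_point).
Proof.
move=> I; rewrite [LHS]represented_vector; congr (_ && _); apply: eq_cycle_free => S _.
by rewrite -(@zero_sum_inj _ _ _ (@trmx 'F_2 1 4)) //; apply: trmx_inj.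
Qed.

(* For [t != 0], these are the vectors of [F_2^2 + F_2^2] that are not blocking. *)
Definition nonblocking (t : 'rV['F_2]_2) : 'rV['F_2]_(2 + 2) := row_mx t (const_mx 1).

Lemma row2_cases (t : 'rV['F_2]_2) : [\/ t = 0, t = 'e_0, t = 'e_1 | t = const_mx 1].
Proof.
have rowE (s : 'rV['F_2]_2) : s 0 0 = t 0 0 -> s 0 1 = t 0 1 -> t = s.
  move=> s0 s1; apply/rowP => i; case: (unliftP ord0 i) => [j|] -> //.
  by rewrite ord1 (_ : lift _ _ = 1) ?s1 //; apply: val_inj.
have := F2_natb (t 0 0); have := F2_natb (t 0 1).
case: (t 0 1 != 0) => t1; case: (t 0 0 != 0) => t0;
  [constructor 4 | constructor 3 | constructor 2 | constructor 1];
  by apply: rowE; rewrite ?t0 ?t1 !mxE.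
Qed.

Lemma nonblocking_neq0 t : nonblocking t != 0.
Proof.
by rewrite row_mx_eq0 negb_and orbC; apply/orP; left; apply/rV0Pn; exists 0; rewrite mxE.
Qed.

Lemma nonblocking_inj : injective nonblocking.
Proof. by move=> s t /eq_row_mx[]. Qed.

Lemma row_free_nonblocking :
  row_free (rows3 (nonblocking 'e_0) (nonblocking 'e_1) (nonblocking (const_mx 1))).
Proof.
have row2_neq (s t : 'rV['F_2]_2) i : s 0 i != t 0 i -> s != t.
  by apply: contraNneq => ->.
apply: row_free_rows3; rewrite ?nonblocking_neq0 ?(inj_eq nonblocking_inj) //.
  by apply: (row2_neq _ _ 0); rewrite !mxE.
rewrite !inE !negb_or nonblocking_neq0 !(inj_eq nonblocking_inj).
rewrite (row2_neq _ _ 1) ?(row2_neq _ _ 0) ?mxE //=.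
rewrite add_row_mx; apply/eqP => /eq_row_mx[_ /rowP/(_ 0)/eqP].
by rewrite !mxE.
Qed.

Lemma in_nonblocking (w : 'rV['F_2]_(2 + 2)) : ~~ blocking_vector (PG32_point w) ->
  w \in [:: nonblocking 'e_0; nonblocking 'e_1; nonblocking (const_mx 1)].
Proof.
rewrite /blocking_vector -ltnNge => many.
have supp_lower : row_supp (dsubmx (PG32_point w)) = setT.
  by apply/eqP; rewrite eqEcard subsetT cardsT card_ord (leq_trans _ many).
have upper_neq0 : lsubmx w != 0.
  apply: contraTneq many => w0; rewrite -trmx_lsub w0 trmx0 eqxx -leqNgt supp_lower.
  by rewrite cardsT card_ord.
have -> : w = nonblocking (lsubmx w).
  rewrite -[LHS]hsubmxK; congr row_mx; apply/rowP => i; rewrite [RHS]mxE.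
  by have := in_setT i; rewrite -supp_lower in_row_supp -trmx_rsub mxE => /F2_neq0.
by case: (row2_cases (lsubmx w)) upper_neq0 => -> //; rewrite !inE eqxx ?orbT.
Qed.

Section LineComplement.

Variables x y : 'rV['F_2]_4.
Hypotheses (x0 : x != 0) (y0 : y != 0) (xy : x != y).

Let L : {set 'rV['F_2]_4} := [set x; y; x + y].
Let E : {set 'rV['F_2]_4} := ground (delete PG32 L).

Lemma in_line_complement v : (v \in E) = (v \notin [:: 0; x; y; x + y]).
Proof. by rewrite !inE !negb_or andbC -!andbA. Qed.

Lemma uniq_line : uniq [:: 0; x; y; x + y].
Proof.
rewrite /= !inE !negb_or ![0 == _]eq_sym x0 y0 xy F2_addr_eq0 xy /=.
by rewrite -![_ == x + y]F2_addr_eq0 addrA [y + _]addrCA !F2_addrr add0r addr0 x0 y0.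
Qed.

Lemma card_line_complement : #|E| = 12%N.
Proof.
have -> : E = ~: [set v in [:: 0; x; y; x + y]].
  by apply/setP => v; rewrite in_line_complement !inE.
have := cardsC [set v in [:: 0; x; y; x + y]].
by rewrite cardsE (card_uniqP uniq_line) card_F2_rows => /(@addnI 4 _ 12).
Qed.

Lemma card_cocycle_line_complement l : l != 0 -> (6 <= #|cocycle PG32_point E l| <= 8)%N.
Proof.
move=> l0; pose N := [set v | (l *m PG32_point v) 0 0 != 0].
have cardN : #|N| = 8%N.
  have := @card_row_nonorthogonal 4 l^T; rewrite trmx_eq0 => /(_ l0).
  rewrite (_ : [set v | _] = N) => [|]; first by lia.
  by apply/setP => v; rewrite !inE -[v *m _]trmxK trmx_mul trmxK mxE.
have inND v w : (v + w \in N) = (v \in N) (+) (w \in N).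
  by rewrite !inE /PG32_point linearD mulmxDr [(_ + _ : 'M_1) 0 0]mxE F2_addr_neq0.
have N0 : 0 \notin N by rewrite -(addr0 0) inND addbb.
have -> : cocycle PG32_point E l = N :\: L.
  apply/setP => v; rewrite in_set in_line_complement !inE; have := N0; rewrite inE.
  by case: (eqVneq v 0) => [-> /negbTE->|_ _]; rewrite ?andbF //= -!orbA.
have NL : (#|N :&: L| <= 2)%N.
  have : N :&: L \proper L.
    rewrite properEneq subsetIr andbT; apply/eqP => /setIidPr/subsetP sLN.
    by have := inND x y; rewrite !sLN ?inE ?eqxx ?orbT.
  move/proper_card => ltL; rewrite -ltnS; apply: leq_trans ltL _.
  by rewrite /L setUC cardsU1 cards2; case: (_ \notin _); case: (_ != _).
by move: NL (cardsID L N); rewrite cardN; move: #|_| #|_| => a b; lia.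
Qed.

Lemma line_complement_not_blocking : ~ blocking_representable E (zero_sum PG32_point).
Proof.
case=> n [g [bg gZ]]; have eq_rep := eq_rep_mx gZ.
have weight (v : 'rV_#|_|) : (v <= rep_mx E g)%MS -> v != 0 -> (6 <= #|col_supp v| <= 8)%N.
  rewrite eq_rep => /submxP[l ->] nv; rewrite -card_ground_supp ground_supp_rep_mx.
  by apply: card_cocycle_line_complement; apply: contraNneq nv => ->; rewrite mul0mx.
have rank4 : \rank (rep_mx E g) = 4%N.
  rewrite eq_rep; apply/eqP; apply: inj_row_free => l lA; apply/eqP; apply: contraT.
  move=> /card_cocycle_line_complement.
  by rewrite -ground_supp_rep_mx card_ground_supp lA col_supp0 cards0.
have [v sv nv|l [rk count avg]] := blocking_rep_mx_bounds bg (w := 6).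
  by have /andP[] := weight v sv nv.
have weightR : (#|col_supp (root_star (rep_mx E g))| <= 8)%N.
  have [->|/(weight _ (root_star_sub _))/andP[]//] := eqVneq (root_star (rep_mx E g)) 0.
  by rewrite col_supp0 cards0.
have := subset_leq_card (col_supp_root_star (rep_mx E g)).
have := rank_leq_row (root_mx (rep_mx E g)).
move: rk count avg; rewrite rank4 card_line_complement; move: weightR.
move: (\rank _) #|col_supp _| #|col_supp _| => d r s.
by case: d => [|[|[|[|d]]]] //; rewrite ?expnS ?expn0; lia.
Qed.

Lemma line_complement_delete e : e \in E ->
  blocking_representable (E :\ e) (zero_sum PG32_point).
Proof.
rewrite in_line_complement => eL.
have [P uP frame] := unitmx_row_free (row_free_rows3 x0 y0 xy eL) row_free_nonblocking.
have frameE k : row k (rows3 x y e) *m P =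
    row k (rows3 (nonblocking 'e_0) (nonblocking 'e_1) (nonblocking (const_mx 1))).
  by rewrite -row_mul frame.
have [xP yP eP] : [/\ x *m P = nonblocking 'e_0, y *m P = nonblocking 'e_1
                    & e *m P = nonblocking (const_mx 1)].
  by have := (frameE 0, frameE 1, frameE (lift 0 1)); rewrite !rowK => -[[]].
exists 2, (fun v => PG32_point (v *m P)); split=> [v|S _]; last exact: zero_sum_PG32_frame.
rewrite in_setD1 in_line_complement => /andP[ve vL]; apply: contraR vL => /in_nonblocking.
rewrite -xP -yP -eP !inE !(inj_eq (can_inj (mulmxK uP))) (negbTE ve) orbF.
by case/orP=> /eqP->; rewrite eqxx ?orbT.
Qed.

Lemma line_complement_contract e : e \in E ->
  blocking_representable (E :\ e) (contract_cycles (zero_sum PG32_point) [set e]).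
Proof.
rewrite in_line_complement inE negb_or => /andP[e0 _].
pose i : 'I_(2 + 2) := rshift 2 1; pose axis : 'rV['F_2]_4 := 'e_i.
have free_rV (v : 'rV['F_2]_4) : v != 0 -> row_free v by rewrite /row_free rank_rV => ->.
have axis0 : axis != 0 by apply/rV0Pn; exists i; rewrite mxE !eqxx.
have [P uP eP] := unitmx_row_free (free_rV e e0) (free_rV axis axis0).
pose g v := PG32_point (v *m P); have ge1 : g e i 0 = 1 by rewrite mxE eP mxE !eqxx.
exists 2, (fun v => g v + g v i 0 *: g e); split=> [v _|S].
  have gvi0 : (g v + g v i 0 *: g e) i 0 = 0.
    by apply/eqP/negbFE; rewrite mxE [X in _ + X]mxE ge1 mulr1 F2_addr_neq0 addbb.
  have lower : row_supp (dsubmx (g v + g v i 0 *: g e)) \subset [set 0].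
    apply/subsetP => j; rewrite in_row_supp mxE inE; case: (unliftP ord0 j) => [j' ->|-> //].
    rewrite (_ : rshift 2 _ = i) ?gvi0 ?eqxx //.
    by apply: val_inj; rewrite /= ord1.
  by apply: leq_trans (subset_leq_card lower) _; rewrite cards1.
rewrite subsetD1 => /andP[_ eS]; rewrite zero_sum_pivot //.
by rewrite !contract_cycles1 !zero_sum_PG32_frame.
Qed.

End LineComplement.

Lemma excluded_minor_line_complement (L : {set 'rV['F_2]_4}) : PG32_line L ->
  excluded_minor even_cycle_with_blocking_pair (delete PG32 L).
Proof.
move=> [x [y [x0 y0 xy ->]]].
apply: (excluded_minor_blocking (zero_sum_space PG32_point)).
- exact/represented_delete/represented_PG32.
- exact: line_complement_not_blocking.
- exact: line_complement_delete.
- exact: line_complement_contract.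
Qed.

(** * Cuts of complete graphs *)

Section CompleteGraphCuts.

Variable n : nat.
Implicit Types (S : {set complete_edge n}) (e : complete_edge n) (a b c x : 'I_n).

Definition cuts : pred {set complete_edge n} := cocycles (@inc_col (complete_graph n)) setT.

Lemma represented_dual_complete : represented (dual (cycle_matroid (complete_graph n))) cuts.
Proof. exact/represented_dual/represented_cycle_matroid. Qed.

Lemma complete_edge_ends e : exists a b, a != b /\ val e = [set a; b].
Proof. by have /cards2P[a [b [ab ->]]] := valP e; exists a, b. Qed.

Lemma complete_edge_exists a b : a != b -> exists e, val e = [set a; b].
Proof.
move=> ab; have ab2 : #|[set a; b]| == 2 by rewrite cards2 ab.
by exists (exist _ [set a; b] ab2).
Qed.

Lemma in_complete_star x e : (e \in @star (complete_graph n) x) = (x \in val e).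
Proof. by rewrite (@in_star (complete_graph n)) /= (valP e) andbT. Qed.

Lemma complete_inc_col_inj : injective (@inc_col (complete_graph n)).
Proof.
move=> e e' eq_col; apply/val_inj/setP => x.
by rewrite -!in_complete_star -!coord_supp_inc_col !inE eq_col.
Qed.

Lemma complete_inc_col_neq0 e : @inc_col (complete_graph n) e != 0.
Proof.
have [a [b [_ eab]]] := complete_edge_ends e; apply/eqP => col0.
have := in_complete_star a e; rewrite -coord_supp_inc_col inE col0 mxE eqxx.
by rewrite eab !inE eqxx.
Qed.

Lemma card_complete_edge : #|{: complete_edge n}| = 'C(n, 2).
Proof.
rewrite card_sig; transitivity 'C(#|'I_n|, 2); last by rewrite card_ord.
by rewrite -card_draws cardsE; apply: eq_card.
Qed.

Definition adjacent S a b := [set a; b] \in val @: S.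

Lemma adjacentC S a b : adjacent S a b = adjacent S b a.
Proof. by rewrite /adjacent setUC. Qed.

Lemma adjacentxx S a : adjacent S a a = false.
Proof.
apply/negP => /imsetP[e _ ea]; have := valP e.
by rewrite /= -ea setUid cards1.
Qed.

Lemma adjacentE S e a b : val e = [set a; b] -> adjacent S a b = (e \in S).
Proof. by move=> eab; rewrite /adjacent -eab (mem_imset _ _ val_inj). Qed.

Lemma in_cocycle_complete (l : 'rV['F_2]_#|vertex (complete_graph n)|) e a b :
  val e = [set a; b] ->
  (e \in cocycle (@inc_col (complete_graph n)) setT l) =
  (l 0 (enum_rank (a : vertex (complete_graph n))) != 0) (+)
  (l 0 (enum_rank (b : vertex (complete_graph n))) != 0).
Proof.
move=> eab; rewrite !inE (inc_colE (eab : @ends (complete_graph n) e = _)).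
by rewrite mulmxDr -!colE !mxE F2_addr_neq0.
Qed.

Lemma cutsP c S :
  reflect (forall a b, adjacent S a b = adjacent S c a (+) adjacent S c b) (cuts S).
Proof.
apply: (iffP existsP) => [[l /eqP SE] a b|cutS].
  pose side x := l 0 (enum_rank (x : vertex (complete_graph n))) != 0.
  suff adjE x y : adjacent S x y = side x (+) side y.
    by rewrite !adjE addbACA addbb.
  have [->|/complete_edge_exists[e exy]] := eqVneq x y; first by rewrite adjacentxx addbb.
  by rewrite (adjacentE S exy) SE (in_cocycle_complete l exy).
exists (\row_j (adjacent S c (enum_val j))%:R); apply/eqP/setP => e.
have [a [b [_ eab]]] := complete_edge_ends e; rewrite (in_cocycle_complete _ eab) !mxE.
by rewrite !enum_rankK !F2_natr_eq0 -(adjacentE S eab) cutS; do 2!case: (adjacent _ _ _).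
Qed.

End CompleteGraphCuts.

Section CutRank.

Variable n : nat.

Lemma card_edges_off_vertex0 :
  #|[set e : complete_edge n.+1 | ord0 \notin val e]| = 'C(n, 2).
Proof.
transitivity 'C(#|[set~ (ord0 : 'I_n.+1)]|, 2); last by rewrite cardsC1 card_ord.
rewrite -cards_draws -(card_imset _ val_inj); apply: eq_card => A; rewrite !inE.
rewrite -disjoints_subset disjoint_sym disjoints1; apply/imsetP/andP => [[e]|[A0 A2]].
  by rewrite inE => e0 ->; split=> //; apply: (valP e).
by exists (exist _ A A2); rewrite ?inE.
Qed.

Lemma cut_free_off_vertex0 :
  cycle_free (@cuts n.+1) [set e : complete_edge n.+1 | ord0 \notin val e].
Proof.
apply/cycle_freeP => S /subsetP sS /(cutsP ord0) cutS; apply/eqP; rewrite -subset0.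
apply/subsetP => e; have [a [b [_ eab]]] := complete_edge_ends e.
suff adj0 x : adjacent S ord0 x = false by rewrite -(adjacentE S eab) cutS !adj0.
by apply/negP => /imsetP[e' /sS]; rewrite inE => e'0 e'E; rewrite -e'E !inE eqxx in e'0.
Qed.

End CutRank.

(** * The dual of K_6 *)

Lemma zero_sum_card_gt2 (T : finType) (V : lmodType 'F_2) (f : T -> V) S :
  injective f -> (forall e, f e != 0) -> zero_sum f S -> S != set0 -> (2 < #|S|)%N.
Proof.
move=> inj_f f0 zS; rewrite -card_gt0; case E: #|S| => [|[|[|]]] // _.
  have /eqP/cards1P[a Sa] := E; move: zS; rewrite Sa /zero_sum big_set1.
  by rewrite (negbTE (f0 a)).
have /eqP/cards2P[a [b [ab Sab]]] := E; move: zS; rewrite Sab zero_sum_setU1 ?inE //.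
by rewrite big_set1 (inj_eq inj_f) eq_sym (negbTE ab).
Qed.

Lemma half_weight m (a r : 'rV['F_2]_m) w : col_supp a \subset col_supp r ->
  #|col_supp r| = (2 * w)%N -> (w <= #|col_supp a|)%N -> (w <= #|col_supp (a + r)|)%N ->
  #|col_supp a| = w.
Proof.
move=> sar cr wa; rewrite col_suppD; have := card_symdiff (col_supp a) (col_supp r).
by rewrite (setIidPl sar) cr; lia.
Qed.

(* Otherwise all nonzero vectors in the span of the two upper rows would have the odd
   weight [w], contradicting the parity of the weight of a sum. *)
Lemma root_mx_not_tight n m (A : 'M['F_2]_(2 + n, m)) w : odd w ->
  (forall v : 'rV_m, (v <= A)%MS -> v != 0%R -> w <= #|col_supp v|)%N ->
  \rank (root_mx A) = 3%N -> #|col_supp (root_star A)| = (2 * w)%N ->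
  #|col_supp (root_mx A)| <> (2 * w)%N.
Proof.
move=> oddw wA rank3 cR cY; have free_root : row_free (root_mx A) by rewrite /row_free rank3.
have suppE : col_supp (root_star A) = col_supp (root_mx A).
  by apply/eqP; rewrite eqEcard col_supp_root_star cR cY leqnn.
have weight (l : 'rV['F_2]_2) : l != 0 -> #|col_supp (l *m usubmx A)| = w.
  move=> l0; have weight_root t : (w <= #|col_supp (l *m usubmx A + t *m root_star A)|)%N.
    rewrite -mul_row_col; apply: wA; first exact: submx_trans (submxMl _ _) (root_mx_sub A).
    apply: contra_neq l0 => lt0; suff /eq_row_mx[] : row_mx l t = row_mx 0 0 by [].
    by apply: (row_free_inj free_root); rewrite lt0 row_mx0 mul0mx.
  apply: half_weight cR _ _.
  - rewrite suppE; apply/subsetP => j; rewrite !inE; apply: contra.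
    by rewrite col_col_mx col_mx_eq0 (col_mulmx l) => /andP[/eqP-> _]; rewrite mulmx0.
  - by have := weight_root 0; rewrite mul0mx addr0.
  - by have := weight_root 1%:M; rewrite mul1mx.
have [a [b [a0 b0 ab0]]] : exists a b : 'rV['F_2]_2, [/\ a != 0, b != 0 & a + b != 0].
  by exists 'e_0, 'e_1; split; apply/rV0Pn; [exists 0 | exists 1 | exists 0]; rewrite !mxE.
have := odd_card_symdiff (col_supp (a *m usubmx A)) (col_supp (b *m usubmx A)).
by rewrite -col_suppD -mulmxDl (weight a a0) (weight b b0) (weight _ ab0) oddw.
Qed.

Lemma dual_K6_not_blocking : ~ blocking_representable setT (@cuts 6).
Proof.
case=> n [g [bg gZ]]; pose A := rep_mx setT g.
have weight (v : 'rV_#|_|) : (v <= A)%MS -> v != 0 -> (3 <= #|col_supp v|)%N.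
  move=> sv nv; rewrite -card_ground_supp.
  apply: (zero_sum_card_gt2 (@complete_inc_col_inj 6) (@complete_inc_col_neq0 6)).
    rewrite zero_sumE; apply/forallP => i; rewrite meets_evenlyC.
    apply: rep_mx_orthogonal sv (subsetT _) _; rewrite gZ ?subsetT //.
    by apply/existsP; exists (delta_mx 0 i); rewrite coord_supp_cocycle.
  rewrite -card_gt0 card_ground_supp; case/rV0Pn: nv => j; rewrite -in_col_supp => vj.
  by apply/card_gt0P; exists j.
have rank10 : (10 <= \rank A)%N.
  rewrite (_ : 10%N = 'C(5, 2)) // -card_edges_off_vertex0.
  apply: rank_rep_mx; rewrite ?subsetT //.
  rewrite (eq_cycle_free (Z2 := @cuts 6)) ?cut_free_off_vertex0 //.
  by move=> S _; rewrite gZ ?subsetT.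
have [l [rk count avg]] := blocking_rep_mx_bounds bg weight.
have := subset_leq_card (col_supp_root_star A); have := rank_leq_row (root_mx A).
have := root_mx_not_tight (isT : odd 3) weight.
have cardE : #|[set: complete_edge 6]| = 15%N by rewrite cardsT card_complete_edge.
move: rk count avg; rewrite -/A cardE; move: rank10.
move: (\rank A) (\rank (root_mx A)) #|col_supp (root_star A)| #|col_supp (root_mx A)| => r d c s.
by case: d => [|[|[|[|d]]]] //; rewrite ?expnS ?expn0; lia.
Qed.

(** * Labelled edge sets *)

Definition vertex_pairs n : seq (nat * nat) :=
  [seq (i, j) | j <- iota 0 n, i <- iota 0 j].

Lemma vertex_pairsP n p : reflect (p.1 < p.2 < n)%N (p \in vertex_pairs n).
Proof.
case: p => i j; apply: (iffP allpairsPdep) => /= [[j' [i' []]]|/andP[ij jn]].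
  by rewrite !mem_iota /= => jn ij [-> ->]; rewrite ij.
by exists j, i; rewrite !mem_iota.
Qed.

Lemma uniq_vertex_pairs n : uniq (vertex_pairs n).
Proof.
apply: allpairs_uniq_dep => [|j _|]; rewrite ?iota_uniq //.
by move=> [j i] [l k] _ _ [/= -> ->].
Qed.

Definition meets_evenly_pairs (s : nat -> nat -> bool) (r : seq (nat * nat)) :=
  ~~ odd (count (fun p => s p.1 p.2) r).

Definition triangle (i j k : nat) := [:: (j, k); (i, j); (i, k)].

Definition root_triangles n := [seq triangle 0 p.1 p.2 | p <- vertex_pairs n & (0 < p.1)%N].

Lemma meets_evenly_triangle s i j k :
  meets_evenly_pairs s (triangle i j k) = (s j k == s i j (+) s i k).
Proof. by rewrite /meets_evenly_pairs /=; case: (s j k); case: (s i j); case: (s i k). Qed.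

Section Labelling.

Variables (n : nat) (labelling : seq 'I_n.+1).
Hypotheses (uniq_labelling : uniq labelling) (size_labelling : size labelling = n.+1).
Implicit Types (S : {set complete_edge n.+1}) (e : complete_edge n.+1) (p : nat * nat)
  (r : seq (nat * nat)).

Definition label i : 'I_n.+1 := nth ord0 labelling i.

Definition label_pair p : {set 'I_n.+1} := [set label p.1; label p.2].

Definition label_edges r : {set complete_edge n.+1} := [set e | val e \in map label_pair r].

Definition label_adjacent S i j := adjacent S (label i) (label j).

Lemma label_inj : {in gtn n.+1 &, injective label}.
Proof.
move=> i j; rewrite !inE => iN jN /eqP.
by rewrite nth_uniq ?size_labelling // => /eqP.
Qed.

Lemma label_onto a : exists2 i, (i < n.+1)%N & a = label i.
Proof.
have full : labelling =i 'I_n.+1.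
  apply/subset_cardP; last exact: subset_predT.
  by rewrite card_ord (card_uniqP uniq_labelling).
have aL : a \in labelling by rewrite full.
exists (index a labelling); last by rewrite /label nth_index.
by rewrite -[X in (_ < X)%N]size_labelling index_mem.
Qed.

Lemma label_pair_inj : {in vertex_pairs n.+1 &, injective label_pair}.
Proof.
move=> [i j] [k l] /vertex_pairsP/andP[/= ij jn] /vertex_pairsP/andP[/= kl ln] /setP eq_pair.
have labelE a b c : (a < n.+1)%N -> (b < n.+1)%N -> (c < n.+1)%N ->
    (label a \in label_pair (b, c)) = (a == b) || (a == c).
  by move=> an bn cn; rewrite !inE !(inj_in_eq label_inj).
have [iN kN] : (i < n.+1)%N /\ (k < n.+1)%N by split; lia.
have := eq_pair (label i); have := eq_pair (label j).
have := eq_pair (label k); have := eq_pair (label l).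
by rewrite !labelE // !eqxx !orbT /= => ? ? ? ?; congr pair; lia.
Qed.

Lemma label_pair_edge e : exists2 p, p \in vertex_pairs n.+1 & val e = label_pair p.
Proof.
have [a [b [ab eab]]] := complete_edge_ends e.
have [i iN ai] := label_onto a; have [j jN bj] := label_onto b.
have nij : i != j by apply: contra_neq ab => ij; rewrite ai bj ij.
have [ij|ji] := ltnP i j.
  by exists (i, j); [apply/vertex_pairsP; rewrite ij jN | rewrite eab ai bj].
exists (j, i); last by rewrite eab setUC ai bj.
by apply/vertex_pairsP; rewrite /= iN ltn_neqAle eq_sym nij ji.
Qed.

Lemma in_label_edges e p r : p \in vertex_pairs n.+1 -> {subset r <= vertex_pairs n.+1} ->
  val e = label_pair p -> (e \in label_edges r) = (p \in r).
Proof.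
move=> pP sr ep; rewrite inE ep; apply/mapP/idP => [[q qr]|pr]; last by exists p.
by move=> /(label_pair_inj pP (sr q qr)) ->.
Qed.

Lemma meets_evenly_label_edges S r : uniq r -> {subset r <= vertex_pairs n.+1} ->
  meets_evenly S (label_edges r) = meets_evenly_pairs (label_adjacent S) r.
Proof.
move=> ur sr; congr (~~ odd _).
have -> : count (fun p => label_adjacent S p.1 p.2) r =
    count (fun A => A \in val @: S) (map label_pair r) by rewrite count_map.
have ulr : uniq (map label_pair r).
  by rewrite map_inj_in_uniq // => p q /sr pP /sr; apply: label_pair_inj.
rewrite -size_filter -(card_uniqP (filter_uniq _ ulr)) -(card_imset _ val_inj).
apply: eq_card => A; rewrite mem_filter; apply/imsetP/andP => [[e]|[/imsetP[e eS ->] Ar]].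
  by rewrite !inE => /andP[eS er] ->; rewrite mem_imset //; apply: val_inj.
by exists e; rewrite // !inE eS.
Qed.

Lemma cuts_root_triangles S :
  cuts S = all (meets_evenly_pairs (label_adjacent S)) (root_triangles n.+1).
Proof.
rewrite all_map; apply/(cutsP (label 0))/allP => [cutS p _|even a b].
  by rewrite /= meets_evenly_triangle -cutS.
have [i iN ->] := label_onto a; have [j jN ->] := label_onto b.
have lt_case k l : (k < l < n.+1)%N ->
    label_adjacent S k l = label_adjacent S 0 k (+) label_adjacent S 0 l.
  move=> kl; case: k kl => [|k] kl; first by rewrite /label_adjacent adjacentxx.
  apply/eqP; rewrite -meets_evenly_triangle; apply: (even (k.+1, l)).
  by rewrite mem_filter; apply/vertex_pairsP.
rewrite -!/(label_adjacent _ _ _); case: (ltngtP i j) => [ij|ji|->].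
- by rewrite lt_case // ij.
- by rewrite /label_adjacent adjacentC addbC -!/(label_adjacent _ _ _) lt_case // ji.
- by rewrite /label_adjacent adjacentxx addbb.
Qed.

Lemma label_adjacentU1 S e p q : p \in vertex_pairs n.+1 -> q \in vertex_pairs n.+1 ->
  val e = label_pair q ->
  label_adjacent (e |: S) p.1 p.2 = (p == q) || label_adjacent S p.1 p.2.
Proof.
move=> pP qP eq; rewrite /label_adjacent /adjacent imsetU1 in_setU1 eq.
by rewrite -!/(label_pair _) (inj_in_eq label_pair_inj).
Qed.

End Labelling.

Lemma labelling_exists n (e : complete_edge n.+2) :
  exists labelling : seq 'I_n.+2, [/\ uniq labelling, size labelling = n.+2
    & val e = label_pair labelling (n, n.+1)].
Proof.
have [a [b [ab eab]]] := complete_edge_ends e; pose rest := enum (~: [set a; b]).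
have size_rest : size rest = n.
  by rewrite -cardE cardsCs setCK card_ord cards2 ab subSS subn1.
exists (rest ++ [:: a; b]); split; last 1 first.
- by rewrite eab /label_pair /label !nth_cat size_rest ltnn subnn ltnNge leqnSn subSnn.
- by rewrite cat_uniq enum_uniq /= andbT inE ab !mem_enum !inE !eqxx orbT orbF andbT.
- by rewrite size_cat size_rest addn2.
Qed.

Definition blocking_column upper lower (p : nat * nat) :=
  (count (fun r : seq (nat * nat) => p \in r) lower <=
   (~~ has (fun r : seq (nat * nat) => p \in r) upper).+1)%N.

Definition pair_row n (r : seq (nat * nat)) := uniq r && all (mem (vertex_pairs n)) r.

Lemma blocking_representable_label_rows n labelling (e : complete_edge n.+2) upper lower
    (Z : pred {set complete_edge n.+2}) :
  uniq labelling -> size labelling = n.+2 -> val e = label_pair labelling (n, n.+1) ->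
  size upper = 2 -> all (pair_row n.+2) (upper ++ lower) ->
  all (blocking_column upper lower) (rem (n, n.+1) (vertex_pairs n.+2)) ->
  (forall S : {set complete_edge n.+2}, S \subset [set~ e] ->
    Z S = all (meets_evenly_pairs (label_adjacent labelling S)) (upper ++ lower)) ->
  blocking_representable [set~ e] Z.
Proof.
move=> uL sL eE size_upper valid few ZE.
have rowsP r : r \in upper ++ lower -> uniq r /\ {subset r <= vertex_pairs n.+2}.
  by move=> /(allP valid)/andP[ur /allP sr].
apply: (@blocking_representable_rows _ _ _ (map (label_edges labelling) upper)
          (map (label_edges labelling) lower)); first by rewrite size_map.
  move=> x; rewrite !inE => xe; have [p pP xp] := label_pair_edge uL sL x.
  have p_off : p \in rem (n, n.+1) (vertex_pairs n.+2).
    rewrite mem_rem_uniq ?uniq_vertex_pairs // inE pP andbT; apply: contraNneq xe => p_last.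
    by rewrite -val_eqE xp eE p_last.
  have countE rs : {subset rs <= upper ++ lower} ->
      count (fun R : {set complete_edge n.+2} => x \in R) (map (label_edges labelling) rs) =
      count (fun r : seq (nat * nat) => p \in r) rs.
    move=> srs; rewrite count_map; apply: eq_in_count => r /srs/rowsP[_ sr].
    exact: (in_label_edges uL sL pP sr xp).
  have := allP few p p_off; rewrite /blocking_column !has_count !countE // => r rP.
    by rewrite mem_cat rP.
  by rewrite mem_cat rP orbT.
move=> S sS; rewrite ZE // -map_cat all_map; apply: eq_in_all => r /rowsP[ur sr] /=.
by rewrite meets_evenly_label_edges.
Qed.

(** * Single-element minors of the dual of K_6 *)

(* In both representations the upper rows are the coordinates in [F_2^2], the lower rows
   are the vertex stars, and [(4, 5)] is the edge being removed. *)
Definition delete_upper := [:: triangle 0 1 2; triangle 1 2 3].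

Definition delete_lower := [::
  [:: (0, 5); (0, 4)]; [:: (1, 4); (1, 5)]; [:: (2, 4); (2, 5)]; [:: (3, 5); (3, 4)];
  [:: (1, 5); (0, 4); (0, 1)]; [:: (2, 5); (1, 4); (1, 2)];
  [:: (3, 4); (0, 3); (0, 5)]; [:: (2, 3); (2, 4); (3, 5)]]%N.

Definition contract_upper := [:: triangle 1 2 3; triangle 1 2 4].

Definition contract_lower := [::
  triangle 0 1 2; triangle 0 1 4; triangle 0 2 5; triangle 0 3 4; triangle 0 3 5;
  triangle 1 3 5; triangle 2 3 4].

(* Read as an equation, a row expresses its first pair by the others; solving for these
   leaves the pairs at vertex [0] and few others. *)
Lemma delete_rows_cut (s : nat -> nat -> bool) : s 4 5 = false ->
  all (meets_evenly_pairs s) (delete_upper ++ delete_lower) =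
  all (meets_evenly_pairs s) (root_triangles 6).
Proof.
move=> s45; rewrite /= /meets_evenly_pairs /= !oddD !oddb !addbF !negb_add s45 !andbT.
apply/idP/idP => [/andP[/eqP-> /andP[/eqP-> /and5P[/eqP-> /eqP-> /eqP-> /eqP->]]]|].
  by move=> /and4P[/eqP-> /eqP-> /eqP->]; do 4!case: (s 0 _)%N; case: (s 1 3)%N.
move=> /and5P[/eqP-> /eqP-> /eqP-> /eqP-> /and5P[/eqP-> /eqP-> /eqP-> /eqP-> /andP[/eqP->]]].
by do 5!case: (s 0 _)%N.
Qed.

Lemma contract_rows_cut (s : nat -> nat -> bool) :
  all (meets_evenly_pairs s) (contract_upper ++ contract_lower) =
  all (meets_evenly_pairs s) (rem (triangle 0 4 5) (root_triangles 6)).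
Proof.
rewrite /= /meets_evenly_pairs /= !oddD !oddb !addbF !negb_add !andbT.
apply/idP/idP => [/and5P[/eqP-> /eqP-> /eqP-> /eqP-> /and4P[/eqP-> /eqP-> /eqP->]]|].
  by do 5!case: (s 0 _)%N; case: (s 1 3)%N; case: (s 1 5)%N.
move=> /and5P[/eqP-> /eqP-> /eqP-> /eqP-> /and5P[/eqP-> /eqP-> /eqP-> /eqP-> /eqP->]].
by do 5!case: (s 0 _)%N.
Qed.

Lemma dual_K6_delete (e : complete_edge 6) : blocking_representable [set~ e] (@cuts 6).
Proof.
have [labelling [uL sL eE]] := labelling_exists e.
apply: (blocking_representable_label_rows (upper := delete_upper) (lower := delete_lower)
          uL sL eE) => // S sS.
rewrite (cuts_root_triangles uL sL) delete_rows_cut //.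
apply/negbTE; rewrite /label_adjacent (adjacentE S eE).
by apply/negP => /(subsetP sS); rewrite !inE eqxx.
Qed.

Lemma dual_K6_contract (e : complete_edge 6) :
  blocking_representable [set~ e] (contract_cycles (@cuts 6) [set e]).
Proof.
have [labelling [uL sL eE]] := labelling_exists e.
apply: (blocking_representable_label_rows (upper := contract_upper) (lower := contract_lower)
          uL sL eE) => // S sS.
have eS : e \notin S by apply/negP => /(subsetP sS); rewrite !inE eqxx.
have adjU i j : (i < j < 6)%N -> label_adjacent labelling (e |: S) i j =
    ((i, j) == (4, 5)%N) || label_adjacent labelling S i j.
  by move=> ij; apply: (label_adjacentU1 uL sL S (p := (i, j))) eE => //; apply/vertex_pairsP.
have adj45 : label_adjacent labelling S 4 5 = false.
  by rewrite /label_adjacent (adjacentE S eE); apply/negbTE.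
rewrite contract_rows_cut contract_cycles1 !(cuts_root_triangles uL sL) /=.
rewrite !meets_evenly_triangle !adjU //= adj45 !andbT.
by case: (_ 0 4 (+) _ 0 5)%N; rewrite /= ?andbT ?andbF ?orbF.
Qed.

Lemma excluded_minor_dual_K6 :
  excluded_minor even_cycle_with_blocking_pair (dual (cycle_matroid (complete_graph 6))).
Proof.
have cuts_space : cycle_space (@cuts 6) := cocycles_space _ _.
apply: (excluded_minor_blocking cuts_space (@represented_dual_complete 6)) => /=.
- exact: dual_K6_not_blocking.
- by move=> e _; rewrite setTD; apply: dual_K6_delete.
- by move=> e _; rewrite setTD; apply: dual_K6_contract.
Qed.

Local Close Scope ring_scope.

Theorem theorem4p4 :
  (forall L : {set 'rV['F_2]_4}, PG32_line L ->
     excluded_minor even_cycle_with_blocking_pair (delete PG32 L)) /\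
  excluded_minor even_cycle_with_blocking_pair
    (dual (cycle_matroid (complete_graph 6))).
Proof.
split; first exact: excluded_minor_line_complement.
exact: excluded_minor_dual_K6.
Qed.
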